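(* Assume the training observable $A:\mathbb{R}\to\mathbb{R}^{N_T}$ is bounded. Then for every $r>0$ there is a constant $C=C(r)>0$ such that for all training observations $\boldsymbol{y}_1,\boldsymbol{y}_2\in\mathbb{R}^{N_T}$ with $\|\boldsymbol{y}_1\|_2,\|\boldsymbol{y}_2\|_2<r$, $$d_{TV}\left(\pi^{\boldsymbol{y}_1},\pi^{\boldsymbol{y}_2}\right)\le C\,\|\boldsymbol{y}_1-\boldsymbol{y}_2\|_2,$$ where $\pi^{\boldsymbol{y}}$ is the posterior distribution on the loop space $\mathcal{L}\mathbb{R}$ defined by $\pi^{\boldsymbol{y}}(d\mathfrak{q})=\int_{W^{\boldsymbol 1}}\mu^{\boldsymbol{y}}(dV)\,\pi^{V}(d\mathfrak{q})$.
   Context: Fix $\beta>0$ (inverse temperature), $M>0$ (mass), $N_T\in\mathbb{N}$. Loop space: $X=\mathcal{L}\mathbb{R}$ is the space of (continuous) loops $\mathfrak{q}:[0,\beta]\to\mathbb{R}$ with $\mathfrak{q}(0)=\mathfrak{q}(\beta)$. Potential space: $V_o(x)=\frac12x^2$, $\mathring V=V-V_o$, and $W^{\boldsymbol 1}=\{V:\ V-V_o\in L^\infty(\mathbb{R})\cap L^2(\mathbb{R})\}$, normed by $\|V\|_{W^{\boldsymbol 1}}=\|V-V_o\|_{L^2}+\|V-V_o\|_{L^\infty}$ (i.e. $W^{\boldsymbol 1}$ is identified with $L^2\cap L^\infty$ via $V\mapsto V-V_o$). Gibbs measures on loops: $\pi_0$ is the probability measure on $X$ given formally by $\pi_0(d\mathfrak{q})\propto\exp\left(-\int_0^\beta[\frac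 M2|\dot{\mathfrak{q}}|^2+V_o(\mathfrak{q}(\tau))]d\tau\right)D[\mathfrak{q}]$, i.e. the centered Gaussian measure on continuous loops with covariance operator $\left(-M\frac{d^2}{d\tau^2}+1\right)^{-1}$ under periodic boundary conditions on $[0,\beta]$. For $V\in W^{\boldsymbol 1}$, $$\pi^V(d\mathfrak{q})=\frac1{\mathcal{Z}^V}\exp\left(-\int_0^\beta\mathring V(\mathfrak{q}(\tau))\,d\tau\right)\pi_0(d\mathfrak{q}),$$ with $\mathcal{Z}^V$ the normalizing constant. Prior on potentials: the Hermite functions are $\phi_n(x)=(-1)^n(2^nn!\sqrt\pi)^{-1/2}e^{x^2/2}\frac{d^n}{dx^n}e^{-x^2}$. $\mu_0$ is the law on $W^{\boldsymbol 1}$ of $V=V_o+\sum_{i\ge0}\gamma_i\xi_i\phi_i$, with $\xi_i$ i.i.d. $\mathcal{N}(0,1)$ and $\{\gamma_i\}$ a fixed real sequence with $\gamma_i=\mathcal{O}(i^{-s})$, $s>\max\{1,\frac{\theta+2}{4(1-\theta)}\}$ for a fixed $\theta\in(0,1)$. Observables: an observable is a measurable function $A$ of position; for loops $\overline A[\mathfrak{q}]=\frac1\beta\int_0^\beta A(\mathfrak{q}(\tau))d\tau$, and $G^A(V)=\mathbb{E}_{\pi^V}\overline A[\mathfrak{q}]$ (componentwise for vector-valued $A$). Posterior on potentials: $\Gamma_{\boldsymbol\eta}\in\mathbb{R}^{N_T\times N_T}$ is a fixed symmetric positive-definite matrix (noise covariance), $$\Phi(V;\boldsymbol{y})=\tfrac12\left\|\Gamma_{\boldsymbol\eta}^{-1/2}(\boldsymbol{y}-G^A(V))\right\|_2^2-\tfrac12\left\|\Gamma_{\boldsymbol\eta}^{-1/2}\boldsymbol{y}\right\|_2^2,$$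 $$\mu^{\boldsymbol{y}}(dV)=\frac1{Z(\boldsymbol{y})}\exp(-\Phi(V;\boldsymbol{y}))\,\mu_0(dV),\qquad Z(\boldsymbol{y})=\int_{W^{\boldsymbol 1}}\exp(-\Phi(V;\boldsymbol{y}))\mu_0(dV).$$ Total variation distance: $d_{TV}(\mu,\mu')=\frac12\int\left|\frac{d\mu}{d\nu}-\frac{d\mu'}{d\nu}\right|d\nu$ for any $\nu$ dominating both. *)

(* Defs.v *)
From HB Require Import structures.
From mathcomp Require Import all_boot all_order all_algebra.
From mathcomp Require Import all_classical all_reals all_analysis.
From mathcomp Require Import measurable_realfun ess_sup_inf.

Set Implicit Arguments.
Unset Strict Implicit.
Unset Printing Implicit Defensive.

Import Order.TTheory GRing.Theory Num.Theory.
Import numFieldNormedType.Exports.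

Local Open Scope classical_set_scope.
Local Open Scope ring_scope.

(* A continuous loop on [0, beta], stored as a function on the whole line.
   The last field fixes the irrelevant values outside [0, beta], so that each
   loop is represented exactly once. *)
Record loop (R : realType) (beta : R) := Loop {
  loop_fun :> R -> R;
  loop_continuous : {within `[0, beta], continuous loop_fun};
  loop_closed : loop_fun 0 = loop_fun beta;
  loop_outside : forall t, t \notin `[0, beta] -> loop_fun t = loop_fun 0 }.

Section loop_measurable.
Context (R : realType) (beta : R).

Definition const_loop (c : R) : loop beta :=
  @Loop R beta (cst c) (continuous_subspaceT (@cst_continuous _ _ c))
    erefl (fun _ _ => erefl).

HB.instance Definition _ := gen_eqMixin (loop beta).
HB.instance Definition _ := gen_choiceMixin (loop beta).
HB.instance Definition _ := isPointed.Build (loop beta) (const_loop 0).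

Definition loop_cylinder : set (set (loop beta)) :=
  [set C | exists t (B : set R),
    [/\ t \in `[0, beta], measurable B & C = [set q : loop beta | B (q t)]]].

(* Generated by the evaluations; as the loop space is separable, this is also
   the Borel sigma-algebra of the uniform norm. *)
Definition loop_space := g_sigma_algebraType loop_cylinder.

End loop_measurable.

Section free_measure.
Context (R : realType) (beta M : R).
Local Notation mu := (@lebesgue_measure R).

Definition inner (f g : R -> R) : R := \int[mu]_(t in `[0, beta]) (f t * g t).

(* u = (- M d^2/dt^2 + 1)^-1 h with periodic boundary conditions, in the
   classical sense.  Periodic functions on [0, beta] are identified with
   beta-periodic functions on the line; h ranges over all the continuous ones. *)
Definition periodic_resolvent (h u : R -> R) : Prop :=
  [/\ forall t, u (t + beta) = u t,
      forall t, derivable u t 1,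
      forall t, derivable (derive1 u) t 1,
      continuous (derive1n 2 u) &
      forall t, h t = - M * derive1n 2 u t + u t].

(* The centered Gaussian measure with covariance operator
   C = (- M d^2/dt^2 + 1)^-1: the law of <h, q> is N(0, <h, C h>).  Testing on
   continuous h determines the measure.  The only excluded case is h = 0, since
   <h, u> = \int_0^beta (M u'^2 + u^2); normal_prob _ 0 is not a Dirac mass. *)
Definition is_free_loop_measure (pi0 : probability (loop_space beta) R) : Prop :=
  forall h u : R -> R, periodic_resolvent h u -> 0 < inner h u ->
  forall B : set R, measurable B ->
    pushforward pi0 (fun q : loop_space beta => inner h q) B =
    normal_prob 0 (Num.sqrt (inner h u)) B.

End free_measure.

Section potentials.
Context (R : realType).
Local Notation mu := (@lebesgue_measure R).

Definition harmonic (x : R) : R := x ^+ 2 / 2.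

Definition W1norm (f : R -> R) : \bar R :=
  ('N[mu]_(2%:E)[EFin \o f] + 'N[mu]_(+oo%E)[EFin \o f])%E.

(* Potentials are taken modulo equality almost everywhere.  A path integral
   \int V(q(t)) dt is computed on the canonical representative; since the law of
   each q(t) under the free measure has a density, other representatives give
   the same value for almost every loop. *)
Record W1 := MkW1 {
  W1_fun :> {mfun_ mu, measurableTypeR R >-> R};
  W1_L2 : finite_norm mu 2%:E (fun x => W1_fun x - harmonic x);
  W1_Loo : finite_norm mu +oo%E (fun x => W1_fun x - harmonic x) }.

Definition perturbation (V : W1) (x : R) : R := V x - harmonic x.

Lemma measurable_harmonic : measurable_fun setT harmonic.
Proof. by apply: measurable_funM => //; exact: measurable_funX. Qed.

Definition harmonic_mfun : {mfun measurableTypeR R >-> R} :=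
  @mfun_Sub _ _ (measurableTypeR R) R harmonic (mem_set measurable_harmonic).

Definition harmonic_class : {mfun_ mu, measurableTypeR R >-> R} :=
  (\pi_({mfun_ mu, measurableTypeR R >-> R}) harmonic_mfun)%qT.

Lemma harmonic_class_finite (p : \bar R) : (1 <= p)%E ->
  finite_norm mu p (fun x => harmonic_class x - harmonic x).
Proof.
move=> p1.
have E : (repr harmonic_class : R -> R) = harmonic %[ae mu].
  apply/asboolP; change (ae_eq_op mu (repr harmonic_class) harmonic_mfun).
  by rewrite -eqmodE reprK.
have mD : measurable_fun setT (fun x => harmonic_class x - harmonic x).
  apply: measurable_funB => //; exact: measurable_harmonic.
have D0 : \forall x \ae mu, (harmonic_class x - harmonic x)%:E = 0%E.
  apply: (@filterS _ _ (ae_filter_ringOfSetsType mu) _ _ _ E) => x Ex.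
  by rewrite /aqEqMfun_to_fun Ex// subrr.
have muT : (0 < mu [set: R])%E.
  by rewrite -set_itvNyy lebesgue_measure_itv ?ltey.
rewrite /finite_norm unlock /Lnorm; case: p p1 => [r r1| |//]; last first.
  move=> _; rewrite muT abs_ess_sup_eq0//.
  by apply: (@filterS _ _ (ae_filter_ringOfSetsType mu) _ _ _ D0) => x + _.
have r0 : r != 0 by rewrite gt_eqF// (lt_le_trans ltr01)// -lee_fin.
suff -> : (\int[mu]_x `|(harmonic_class x - harmonic x)%:E| `^ r = 0)%E.
  by rewrite poweR0r ?invr_neq0.
rewrite (ge0_ae_eq_integral (g := cst 0%E)) ?integral0//.
- apply: (measurableT_comp (measurable_poweR r)) => //.
  by apply: measurableT_comp => //; apply/measurable_EFinP.
- by move=> x _; exact: poweR_ge0.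
- apply: (@filterS _ _ (ae_filter_ringOfSetsType mu) _ _ _ D0) => x Dx _.
  by rewrite Dx abse0 poweR0r.
Qed.


HB.instance Definition _ := gen_eqMixin W1.
HB.instance Definition _ := gen_choiceMixin W1.
HB.instance Definition _ := isPointed.Build W1
  (MkW1 (harmonic_class_finite (lee1n 2)) (harmonic_class_finite (leey 1))).

Definition W1dist (V V' : W1) : \bar R :=
  W1norm (fun x => perturbation V x - perturbation V' x).

(* The open sets of the norm of L^2 \cap L^oo. *)
Definition W1_open : set (set W1) :=
  [set U | forall V, U V ->
    exists2 e : R, 0 < e & forall V', (W1dist V' V < e%:E)%E -> U V'].

Definition W1_space := g_sigma_algebraType W1_open.

End potentials.

Section prior.
Context (R : realType).

Definition hermite_fun (n : nat) (x : R) : R :=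
  (-1) ^+ n * (Num.sqrt (2 ^+ n * n`!%:R * Num.sqrt pi))^-1 *
  expR (x ^+ 2 / 2) * derive1n n (fun z : R => expR (- z ^+ 2)) x.

Definition mutually_independent d (Omega : measurableType d)
    (P : probability Omega R) (X : nat -> {RV P >-> R}) : Prop :=
  forall (s : seq nat) (B : nat -> set R), uniq s ->
    (forall i, measurable (B i)) ->
    P (\bigcap_(i in [set` s]) X i @^-1` B i) =
    (\prod_(i <- s) P (X i @^-1` B i))%E.

(* mu0 is the law of V_o + \sum_i gamma_i xi_i phi_i; the series converges
   almost surely in W1. *)
Definition is_prior (gamma : nat -> R) (mu0 : probability (W1_space R) R) :=
  exists (d : measure_display) (Omega : measurableType d)
    (P : probability Omega R) (xi : nat -> {RV P >-> R})
    (V : {RV P >-> W1_space R}),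
  [/\ mutually_independent xi,
      forall i (B : set R), measurable B ->
        distribution P (xi i) B = normal_prob 0 1 B,
      \forall w \ae P,
        (fun n => W1norm (fun x => perturbation (V w) x -
            \sum_(i < n) gamma i * xi i w * hermite_fun i x)) @ \oo --> 0%E &
      forall B : set (W1_space R), measurable B -> mu0 B = distribution P V B].

End prior.

Section observations.
Context (R : realType).

Definition norm2 (n : nat) (v : 'cV[R]_n) : R :=
  Num.sqrt (\sum_i v i 0 ^+ 2).

Definition posdefmx (n : nat) (G : 'M[R]_n) : Prop :=
  G^T = G /\ forall v : 'cV[R]_n, v != 0 -> 0 < (v^T *m G *m v) 0 0.

(* G^(-1/2): the symmetric positive definite square root of G^-1, which exists
   and is unique when G is symmetric positive definite. *)
Definition inv_sqrtmx (n : nat) (G : 'M[R]_n) : 'M[R]_n :=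
  xget 0 [set S | posdefmx S /\ S *m S = invmx G].

End observations.

(* The Gibbs measures and the posteriors are set functions, meaningful on
   measurable sets; that they are probability measures is a fact about them,
   not part of the definitions. *)
Section measures.
Context (R : realType) (beta : R) (n : nat).
Variables (pi0 : probability (loop_space beta) R).
Variables (mu0 : probability (W1_space R) R).
Variables (Gamma : 'M[R]_n) (A : R -> 'cV[R]_n).

Definition gibbs_weight (V : W1_space R) (q : loop_space beta) : \bar R :=
  (expR (- \int[lebesgue_measure]_(t in `[0, beta]) perturbation V (q t)))%:E.

Definition gibbs_Z (V : W1_space R) : R :=
  fine (\int[pi0]_q gibbs_weight V q)%E.

Definition gibbs (V : W1_space R) (B : set (loop_space beta)) : \bar R :=
  ((gibbs_Z V)^-1%:E * \int[pi0]_(q in B) gibbs_weight V q)%E.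

Definition loop_average (f : R -> R) (q : loop_space beta) : R :=
  beta^-1 * \int[lebesgue_measure]_(t in `[0, beta]) f (q t).

Definition obs_mean (V : W1_space R) : 'cV[R]_n :=
  \col_i fine (\int[gibbs V]_q (loop_average (fun x => A x i 0%R) q)%:E)%E.

Definition neg_log_lik (y : 'cV[R]_n) (V : W1_space R) : R :=
  2^-1 * norm2 (inv_sqrtmx Gamma *m (y - obs_mean V)) ^+ 2 -
  2^-1 * norm2 (inv_sqrtmx Gamma *m y) ^+ 2.

Definition posterior_Z (y : 'cV[R]_n) : R :=
  fine (\int[mu0]_V (expR (- neg_log_lik y V))%:E)%E.

Definition posterior (y : 'cV[R]_n) (B : set (W1_space R)) : \bar R :=
  ((posterior_Z y)^-1%:E * \int[mu0]_(V in B) (expR (- neg_log_lik y V))%:E)%E.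

Definition loop_posterior (y : 'cV[R]_n) (B : set (loop_space beta)) : \bar R :=
  (\int[posterior y]_V gibbs V B)%E.

End measures.

Section total_variation.
Context d (T : measurableType d) (R : realType).

Definition is_density (nu : {measure set T -> \bar R}) (f : T -> R)
    (P : set T -> \bar R) : Prop :=
  [/\ measurable_fun setT f, forall x, 0 <= f x &
      forall B, measurable B -> P B = (\int[nu]_(x in B) (f x)%:E)%E].

(* For finite measures P and Q the set below is a singleton, as the value does
   not depend on the dominating measure nu.  If P or Q is not a measure on the
   measurable sets then the set is empty and the value is +oo. *)
Definition dTV (P Q : set T -> \bar R) : \bar R :=
  ereal_inf [set e | exists (nu : {sigma_finite_measure set T -> \bar R})
                       (f g : T -> R),
    [/\ is_density nu f P, is_density nu g Q &
        e = (2^-1%:E * \int[nu]_x `|f x - g x|%:E)%E]].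

End total_variation.

(* Main.v *)
From HB Require Import structures.
Require Import Defs.
From mathcomp Require Import all_boot all_order all_algebra.
From mathcomp Require Import all_classical all_reals all_analysis.
From mathcomp Require Import ring lra measurable_realfun ess_sup_inf.
Import Order.TTheory GRing.Theory Num.Theory.
Import numFieldNormedType.Exports.
Local Open Scope classical_set_scope.
Local Open Scope ring_scope.
Set Implicit Arguments.
Unset Strict Implicit.
Unset Printing Implicit Defensive.

(** The two posteriors on loops are compared multiplicatively.  If two
    probabilities [P] and [Q] satisfy [P <= k Q] and [Q <= k P] on measurable
    sets, then their total variation distance is at most [k - 1]
    ([dTV_le_ratio], with the density of [P] with respect to [Q]).  Such bounds
    come from densities: if two weights have their ratio between [1/k] and [k],
    the normalised measures that they define have it between [1/k^2] and [k^2]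
    ([tilt_le_tilt]).

    Once expanded, the negative log-likelihood is affine in the data
    ([neg_log_likE]), with a linear part bounded uniformly over the potentials
    because the observables are bounded.  Hence the likelihoods of [y1] and [y2]
    have a ratio at most [exp (L |y1 - y2|)], the posteriors on potentials, and
    then their mixtures of Gibbs measures, a ratio at most
    [exp (2 L |y1 - y2|)], and [exp x - 1 <= x exp x] gives the Lipschitz bound
    on a ball.

    What takes work is that these mixtures are measures at all, that is, that
    the Gibbs probability of a fixed event is a measurable function of the
    potential, for the Borel sets of the norm of [L^2 /\ L^oo].  The same
    comparison of weights shows that it is lower semicontinuous
    ([gibbs_close], [measurable_gibbs]), provided that potentials which are
    close almost everywhere have close path integrals along almost every loop.
    By Fubini's theorem this holds as soon as the law of [q t] is absolutely
    continuous for every [t] between [0] and [beta] ([ae_along_paths]).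

    The law of [q t] has to be extracted from the laws of the pairings [<h, q>]
    with continuous [h].  The Fejer kernel centred at [t] is a trigonometric
    polynomial, so its image under [(- M d^2/dt^2 + 1)^-1] is explicit; its
    pairings with a loop converge to [q t] ([inner_fejer_cvg]) and are Gaussian
    with variance at least [beta^-1] ([inner_fejer_ge]).  Their densities are
    therefore bounded by a common constant, and this passes to the limit on open
    sets ([one_time_law_open]). *)

(** * Tilted measures, mixtures and total variation *)

Section exponential_tilting.
Context d (T : measurableType d) (R : realType) (P : probability T R).
Local Open Scope ereal_scope.
Implicit Types (w : T -> R) (B : set T).

Definition tilt w B : \bar R :=
  (fine (\int[P]_x (w x)%:E))^-1%:E * \int[P]_(x in B) (w x)%:E.

(** Positivity everywhere keeps the normalising constant away from zero.  The
    upper bound is required only almost everywhere, since a potential is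
    bounded only essentially. *)
Definition weight w : Prop :=
  [/\ measurable_fun setT w, forall x, (0 < w x)%R
    & exists K : R, \forall x \ae P, (w x <= K)%R].

Lemma weight_EFin w D : weight w -> measurable_fun D (fun x => (w x)%:E).
Proof.
by move=> [mw _ _]; apply/measurable_EFinP; exact: measurable_funTS.
Qed.

Lemma weight_ge0 w x : weight w -> 0 <= (w x)%:E.
Proof. by move=> [_ w0 _]; rewrite lee_fin ltW. Qed.

Lemma weight_int_fin w : weight w ->
  exists2 z : R, (0 < z)%R & \int[P]_x (w x)%:E = z%:E.
Proof.
move=> hw; have [mw w0 [K wK]] := hw.
have I0 : 0 <= \int[P]_x (w x)%:E.
  by apply: integral_ge0 => x _; exact: weight_ge0.
have Ily : \int[P]_x (w x)%:E <= (Num.max K 0)%:E.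
  rewrite -[leRHS]mule1 -(probability_setT P) -integral_cst//.
  apply: ae_ge0_le_integral => //.
  - by move=> x _; exact: weight_ge0.
  - exact: weight_EFin.
  - by move=> x _; rewrite lee_fin le_max lexx orbT.
  - by apply: filterS wK => x wxK _; rewrite lee_fin le_max wxK.
have Ifin : \int[P]_x (w x)%:E \is a fin_num.
  by rewrite ge0_fin_numE// (le_lt_trans Ily)// ltry.
exists (fine (\int[P]_x (w x)%:E)); last by rewrite fineK.
rewrite lt_neqAle fine_ge0// andbT; apply/eqP => I00.
have : \int[P]_x `|(w x)%:E| = 0.
  rewrite (eq_integral (fun x => (w x)%:E)); last first.
    by move=> x _; rewrite gee0_abs ?weight_ge0.
  by rewrite -(fineK Ifin) -I00.
move/(ae_eq_integral_abs _ measurableT (weight_EFin (D:=setT) hw)).1.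
move=> [N [mN PN sN]].
have NT : N = setT.
  rewrite -subTset => x _; apply: sN => /= /(_ I).
  by move=> [wx0]; have := w0 x; rewrite wx0 ltxx.
have : P setT = 0 by rewrite -NT; exact: PN.
by rewrite probability_setT => /eqP; rewrite onee_eq0.
Qed.

Section tilted_measure.
Variables (w : T -> R) (hw : weight w).

(** The proof argument carries the hypothesis from which the measure structure
    is inferred; [mixture] below follows the same pattern. *)
Definition mtilt of weight w := tilt w.

Let mtilt0 : mtilt hw set0 = 0.
Proof. by rewrite /mtilt /tilt integral_set0 mule0. Qed.

Let mtilt_ge0 B : 0 <= mtilt hw B.
Proof.
have [z z0 zE] := weight_int_fin hw.
rewrite /mtilt /tilt zE mule_ge0 ?lee_fin ?invr_ge0 ?(ltW z0)//.
by apply: integral_ge0 => x _; exact: weight_ge0.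
Qed.

Let mtilt_sigma_additive : semi_sigma_additive (mtilt hw).
Proof.
move=> F mF tF mUF; rewrite /mtilt /tilt.
rewrite (ge0_integral_bigcup P mF) //; last 2 first.
- exact: weight_EFin.
- by move=> x _; exact: weight_ge0.
set c := (fine _)^-1%R.
have c0 : (0 <= c)%R.
  have [z z0 zE] := weight_int_fin hw.
  by rewrite /c zE invr_ge0 ltW.
rewrite -nneseriesZl//; last first.
  by move=> n _; apply: integral_ge0 => x _; exact: weight_ge0.
apply: is_cvg_ereal_nneg_natsum => n _.
rewrite mule_ge0 ?lee_fin//.
by apply: integral_ge0 => x _; exact: weight_ge0.
Qed.

HB.instance Definition _ := isMeasure.Build _ _ _ (mtilt hw)
  mtilt0 mtilt_ge0 mtilt_sigma_additive.

Let mtiltT : mtilt hw setT = 1.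
Proof.
have [z z0 zE] := weight_int_fin hw.
by rewrite /mtilt /tilt zE /= -EFinM mulVf ?gt_eqF.
Qed.

HB.instance Definition _ :=
  Measure_isProbability.Build _ _ _ (mtilt hw) mtiltT.

End tilted_measure.

(** The factor [k] is paid twice: once for the unnormalised mass of [B], and
    once for the normalising constant. *)
Lemma tilt_le_tilt w1 w2 (k : R) B : weight w1 -> weight w2 ->
  measurable B ->
  (\forall x \ae P, (w1 x <= k * w2 x)%R) ->
  (\forall x \ae P, (w2 x <= k * w1 x)%R) ->
  tilt w1 B <= (k * k)%:E * tilt w2 B.
Proof.
move=> hw1 hw2 mB w12 w21.
have [z1 z10 z1E] := weight_int_fin hw1.
have [z2 z20 z2E] := weight_int_fin hw2.
have k0 : (0 <= k)%R.
  rewrite leNgt; apply/negP => k0.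
  case: w12 => N [mN PN sN].
  have NT : N = setT.
    rewrite -subTset => x _; apply: sN => /=.
    case: hw1 hw2 => [_ w10 _] [_ w20 _].
    move=> le; have := lt_le_trans (w10 x) le.
    by rewrite pmulr_lgt0 ?w20// => /ltW; rewrite leNgt k0.
  have : P setT = 0 by rewrite -NT; exact: PN.
  by rewrite probability_setT => /eqP; rewrite onee_eq0.
have le w w' D : weight w -> weight w' -> measurable D ->
    (\forall x \ae P, (w x <= k * w' x)%R) ->
    \int[P]_(x in D) (w x)%:E <= k%:E * \int[P]_(x in D) (w' x)%:E.
  move=> hw hw' mD ww'.
  rewrite -ge0_integralZl_EFin//; last 2 first.
  - by move=> x _; exact: weight_ge0.
  - exact: weight_EFin.
  apply: ae_ge0_le_integral => //.
  - by move=> x _; exact: weight_ge0.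
  - exact: weight_EFin.
  - move=> x _; apply: mule_ge0; first by rewrite lee_fin.
    exact: weight_ge0.
  - by apply: measurable_funeM; exact: weight_EFin.
  - by apply: filterS ww' => x + _; rewrite -EFinM lee_fin.
have zz : (z1^-1 <= k * z2^-1)%R.
  have := le _ _ setT hw2 hw1 measurableT w21.
  rewrite z1E z2E -EFinM lee_fin => zz.
  by rewrite ler_pdivlMr// mulrC ler_pdivrMr// .
rewrite /tilt z1E z2E /=.
apply: (le_trans (lee_pmul _ _ (_ : _ <= (k * z2^-1)%:E)
  (le _ _ _ hw1 hw2 mB w12))); rewrite ?lee_fin ?invr_ge0 ?(ltW z10)//.
  by apply: integral_ge0 => x _; exact: weight_ge0.
rewrite muleA -EFinM muleA -EFinM.
by rewrite [X in (X%:E * _ <= _)%E](_ : _ = (k * k * z2^-1)%R)//; ring.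
Qed.

End exponential_tilting.

Section mixture.
Context d d' (X : measurableType d) (T : measurableType d') (R : realType).
Implicit Types (Q : probability X R) (kap : X -> probability T R).
Local Open Scope ereal_scope.

Definition measurable_family kap : Prop := forall B, measurable B ->
  measurable_fun [set: X] (fun x => kap x B).

Definition mixture Q kap & measurable_family kap : set T -> \bar R :=
  fun B => \int[Q]_x kap x B.

Variables (Q : probability X R) (kap : X -> probability T R).
Variable mkap : measurable_family kap.
Local Notation mixt := (mixture Q mkap).

Let mixture0 : mixt set0 = 0.
Proof. by rewrite /mixture integral0_eq. Qed.

Let mixture_ge0 B : 0 <= mixt B.
Proof. by apply: integral_ge0 => x _; exact: measure_ge0. Qed.

Let mixture_sigma_additive : semi_sigma_additive mixt.
Proof.
move=> F mF tF mUF; rewrite /mixture.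
rewrite (eq_integral (fun x => \sum_(0 <= i <oo) kap x (F i))); last first.
  by move=> x _; rewrite measure_semi_bigcup.
rewrite integral_nneseries//; last by move=> n; exact: mkap.
by apply: is_cvg_ereal_nneg_natsum => n _; apply: integral_ge0.
Qed.

HB.instance Definition _ := isMeasure.Build _ _ _ mixt
  mixture0 mixture_ge0 mixture_sigma_additive.

Let mixtureT : mixt setT = 1.
Proof.
rewrite /mixture (eq_integral (cst 1)); last first.
  by move=> x _; exact: probability_setT.
by rewrite integral_cst// mul1e; exact: probability_setT.
Qed.

HB.instance Definition _ :=
  Measure_isProbability.Build _ _ _ mixt mixtureT.

End mixture.

Section total_variation_ratio.
Context d (T : measurableType d) (R : realType).
Local Open Scope ereal_scope.

Let half_excess (P Q : probability T R) (k : R) (f g : T -> R)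
    (nu : {measure set T -> \bar R}) (E : set T) : measurable E ->
  is_density nu f P -> is_density nu g Q ->
  (forall B, measurable B -> P B <= k%:E * Q B) -> (1 <= k)%R ->
  (forall x, E x -> (g x <= f x)%R) ->
  \int[nu]_(x in E) `|f x - g x|%:E <= (k - 1)%:E.
Proof.
move=> mE [mf f0 fE] [mg g0 gE] PQ k1 gf.
have Qfin := fin_num_measure Q E mE; have Pfin := fin_num_measure P E mE.
have : \int[nu]_(x in E) `|f x - g x|%:E + Q E = P E.
  rewrite gE// fE// -ge0_integralD//=.
  - apply: eq_integral => x /set_mem Ex.
    by rewrite ger0_norm ?subr_ge0 ?gf// -EFinD subrK.
  - apply/measurable_EFinP; apply: measurableT_comp => //.
    by apply: measurable_funTS; exact: measurable_funB.
  - by move=> x _; rewrite lee_fin.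
  - by apply/measurable_EFinP; exact: measurable_funTS.
move/(congr1 (fun z => z - Q E)); rewrite addeK// => ->.
have := PQ E mE; have : Q E <= 1 by exact: probability_le1.
rewrite -(fineK Qfin) -(fineK Pfin) -EFinM -EFinB !lee_fin => Q1 PkQ.
have : (0 <= fine (Q E))%R by rewrite fine_ge0.
by nra.
Qed.

(** The density of [P] is taken with respect to [Q] itself: the two-sided
    bound makes the excess of either measure over the other, on the set where
    its density is larger, at most [k - 1]. *)
Lemma dTV_le_ratio (P Q : probability T R) (k : R) : (1 <= k)%R ->
  (forall B, measurable B -> P B <= k%:E * Q B) ->
  (forall B, measurable B -> Q B <= k%:E * P B) ->
  dTV P Q <= (k - 1)%:E.
Proof.
move=> k1 PQ QP.
have PaQ : P `<< Q.
  apply/null_content_dominatesP => B mB QB0; apply/eqP.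
  by rewrite eq_le measure_ge0 andbT (le_trans (PQ B mB))// QB0 mule0.
have [f [f0 ffin /integrableP[mf _] fE]] := radon_nikodym_sigma_finite PaQ.
pose h := fine \o f.
have hE x : (h x)%:E = f x by rewrite /h /= fineK.
have mh : measurable_fun setT h.
  apply/measurable_EFinP; apply: eq_measurable_fun mf => x _.
  by rewrite -hE.
have dP : is_density Q h P.
  split => // [x|B mB]; first by rewrite fine_ge0.
  by rewrite fE//; apply: eq_integral => x _; rewrite hE.
have dQ : is_density Q (cst 1%R) Q.
  split => // B mB; transitivity (\int[Q]_(x in B) cst 1 x) => //.
  by rewrite integral_cst// mul1e.
apply: (@le_trans _ _ (2^-1%:E * \int[Q]_x `|h x - 1|%:E)).
  by apply: ereal_inf_lbound; exists Q, h, (cst 1%R).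
pose E := [set x | (1 <= h x)%R].
have mE : measurable E by rewrite -[E]setTI; exact: measurable_fun_le.
have mh1 D : measurable_fun D (fun x => `|h x - 1|%:E).
  apply/measurable_EFinP; apply: measurableT_comp => //.
  by apply: measurable_funTS; exact: measurable_funB.
rewrite -(setUv E) ge0_integral_setU//; last 2 first.
- exact: measurableC.
- by apply/disj_setPCl.
have I1 := half_excess mE dP dQ PQ k1 (fun x Ex => Ex).
have I2 : \int[Q]_(x in ~` E) `|h x - 1|%:E <= (k - 1)%:E.
  under eq_integral do rewrite distrC.
  apply: (half_excess (measurableC mE) dQ dP QP k1) => x /negP.
  by rewrite -ltNge => /ltW.
apply: (@le_trans _ _ (2^-1%:E * ((k - 1)%:E + (k - 1)%:E))%E).
  apply: lee_pmul => //; last exact: leeD.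
  by apply: adde_ge0; apply: integral_ge0.
rewrite -EFinD -EFinM lee_fin.
by lra.
Qed.

End total_variation_ratio.

(** * Joint measurability of time and path *)

Section path_evaluation.
Context (R : realType) (beta : R).
Hypothesis beta_gt0 : 0 < beta.
Local Notation mu := (@lebesgue_measure R).
Local Notation D := [set` `[0, beta]].
Local Notation DX :=
  ([set` `[0, beta]] `*` setT : set (measurableTypeR R * loop_space beta)).

Let zeroD : 0 \in `[0, beta]. Proof. by rewrite in_itv/= lexx ltW. Qed.

Lemma measurable_loop_eval (t : R) :
  measurable_fun [set: loop_space beta] (fun q : loop_space beta => q t).
Proof.
wlog tD : t / t \in `[0, beta].
  move=> H; have [|tD] := boolP (t \in `[0, beta]); first exact: H.
  apply: (eq_measurable_fun (fun q : loop_space beta => q 0)).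
    by move=> q _; rewrite loop_outside.
  exact: H.
move=> _ B mB; rewrite setTI; apply: sub_sigma_algebra.
by exists t, B; split.
Qed.

(** A continuous path is the pointwise limit of its piecewise constant
    discretisations, for which joint measurability is a countable union of
    measurable rectangles. *)
Lemma measurable_path : measurable_fun DX
  (fun p : measurableTypeR R * loop_space beta => p.2 p.1).
Proof.
have mD : measurable DX by exact: measurableX.
pose g (n : nat) (t : R) : R := (Num.truncn (t * n.+1%:R))%:R / n.+1%:R.
apply: (@measurable_fun_cvg _ _ _ _
    (fun n (p : measurableTypeR R * loop_space beta) => p.2 (g n p.1)))
  => [n|[t q] [/= tD _]].
  pose A (B : set R) k : set (measurableTypeR R * loop_space beta) :=
    [set t | k%:R <= t * n.+1%:R < k.+1%:R] `*`
    [set q : loop_space beta | B (q (k%:R / n.+1%:R))].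
  move=> _ B mB.
  rewrite [X in measurable X](_ : _ =
      DX `&` \bigcup_k A B k); last first.
    apply/seteqP; split => -[t q] /= [] [tD _] H; split => //.
      exists (Num.truncn (t * n.+1%:R)) => //; split => //=.
      apply: truncn_itv; rewrite mulr_ge0//.
      by move: tD; rewrite in_itv/= => /andP[].
    case: H => k _ [/= tk Bq]; rewrite /g.
    by rewrite (truncn_def tk).
  apply: measurableI => //; apply: bigcup_measurable => k _.
  apply: measurableX.
    rewrite [X in measurable X](_ : _ =
      (fun t : R => t * n.+1%:R) @^-1` `[k%:R, k.+1%:R[); last first.
      by apply/seteqP; split => t /=; rewrite in_itv.
    rewrite -[X in measurable X]setTI; apply: measurable_funM => //.
  by rewrite -[X in measurable X]setTI; apply: measurable_loop_eval.
have t0 : 0 <= t by move: tD; rewrite in_itv/= => /andP[].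
have g0 n : 0 <= g n t by rewrite divr_ge0.
have gt n : g n t <= t < g n t + n.+1%:R^-1.
  have /andP[a b] := truncn_itv (mulr_ge0 t0 (ler0n R n.+1)).
  rewrite ler_pdivrMr// a/=.
  by rewrite -[X in _ < _ + X]mul1r -mulrDl ltr_pdivlMr// natr1.
have gD n : D (g n t).
  rewrite /= in_itv/= g0/=; have /andP[+ _] := gt n => /le_trans; apply.
  by move: tD; rewrite in_itv/= => /andP[].
have gcvg : g ^~ t @ \oo --> t.
  apply: (@squeeze_cvgr _ _ _ _ (fun n => t - n.+1%:R^-1) (cst t)).
  - apply: nearW => n; have /andP[-> /ltW] := gt n.
    by rewrite lerBlDr => ->.
  - rewrite -[X in _ --> X]subr0; apply: cvgB; first exact: cvg_cst.
    exact: cvg_harmonic.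
  - exact: cvg_cst.
have qc : {within D, continuous q} := @loop_continuous _ _ q.
move/subspace_continuousP: qc => /(_ t tD) qc.
apply: (@cvg_comp _ _ _ (g ^~ t) q _ _ _ _ qc) => U /= DU.
have H : \forall n \near \oo, D (g n t) -> U (g n t) by exact: (gcvg _ DU).
change (\forall n \near \oo, U (g n t)).
by apply: filterS H => n; apply; exact: gD.
Qed.

Lemma measurable_path_comp (f : R -> R) : measurable_fun setT f ->
  measurable_fun DX
    (fun p : measurableTypeR R * loop_space beta => f (p.2 p.1)).
Proof. by move=> mf; exact: (measurableT_comp mf measurable_path). Qed.

Lemma measurable_section (F : measurableTypeR R * loop_space beta -> R)
    (q : loop_space beta) :
  measurable_fun DX F ->
  measurable_fun D (fun t => F (t, q)).
Proof.
move=> mF; apply: (@measurable_comp _ _ _ _ _ _ DX F).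
- exact: measurableX.
- by move=> _ [t tD <-].
- exact: mF.
- by apply: measurable_funTS; exact: pair2_measurable.
Qed.

Lemma measurable_time_integral (F : measurableTypeR R * loop_space beta -> R) :
  measurable_fun DX F ->
  measurable_fun [set: loop_space beta]
    (fun q => \int[mu]_(t in D) F (t, q)).
Proof.
move=> mF.
have mD : measurable DX by exact: measurableX.
have pos (G : measurableTypeR R * loop_space beta -> \bar R) :
    (forall p, 0 <= G p)%E ->
    measurable_fun DX G ->
    measurable_fun [set: loop_space beta]
      (fun q => \int[mu]_(t in D) G (t, q))%E.
  move=> G0 mG.
  rewrite (_ : (fun q => _) = fubini_G mu (G \_ DX)); last first.
    apply/funext => q; rewrite /fubini_G [LHS]integral_mkcond.
    apply: eq_integral => t _; rewrite /patch.
    by congr (if _ then _ else _); apply/idP/idP; rewrite !inE//= => -[].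
  apply: measurable_fun_fubini_tonelli_G.
  - exact: ((measurable_restrictT _ mD).1 mG).
  - by move=> p; rewrite /patch; case: ifP.
apply: (measurableT_comp (f := fine)); first exact: fine_measurable.
under eq_fun do rewrite integralE.
have mFE : measurable_fun DX (EFin \o F).
  exact/measurable_EFinP.
apply: emeasurable_funB.
- have m := pos _ (funepos_ge0 (EFin \o F)) (measurable_funepos mFE).
  by apply: eq_measurable_fun m => q _; apply: eq_integral => t _;
    rewrite !funeposE.
- have m := pos _ (funeneg_ge0 (EFin \o F)) (measurable_funeneg mFE).
  by apply: eq_measurable_fun m => q _; apply: eq_integral => t _;
    rewrite !funenegE.
Qed.

End path_evaluation.

(** * Trigonometric sums *)

Section trigonometric_modes.
Context (R : realType).
Local Notation mu := (@lebesgue_measure R).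

Lemma is_derive_affine (p a t : R) :
  is_derive t 1 (fun s : R => p * (s - a)) p.
Proof.
rewrite (_ : (fun s => _) = p *: (id - cst a)); last by [].
by apply: is_derive_eq; rewrite subr0 /GRing.scale/= mulr1.
Qed.

Lemma is_derive_cos_affine (p a t : R) :
  is_derive t 1 (fun s : R => cos (p * (s - a))) (- (p * sin (p * (t - a)))).
Proof.
have H := is_derive_affine p a t.
have := @is_derive1_comp R cos _ t _ _ (is_derive_cos (p * (t - a))) H.
by move=> H2; apply: is_derive_eq; rewrite mulNr mulrC.
Qed.

Lemma is_derive_sin_affine (p a t : R) :
  is_derive t 1 (fun s : R => sin (p * (s - a))) (p * cos (p * (t - a))).
Proof.
have H := is_derive_affine p a t.
have := @is_derive1_comp R sin _ t _ _ (is_derive_sin (p * (t - a))) H.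
by move=> H2; apply: is_derive_eq; rewrite mulrC.
Qed.

Lemma continuous_cos_affine (p a : R) :
  continuous (fun t : R => cos (p * (t - a))).
Proof.
move=> t; apply: differentiable_continuous; apply/derivable1_diffP.
by apply: ex_derive; exact: is_derive_cos_affine.
Qed.

Lemma cosD2pi_int (x : R) (k l : nat) :
  cos (x + (k%:R - l%:R) * (pi *+ 2)) = cos x.
Proof.
rewrite -(periodicn (@cosD2pi R) l) -[RHS](periodicn (@cosD2pi R) k).
congr cos; rewrite -[_ *+ 2 *+ l]mulr_natl -[_ *+ 2 *+ k]mulr_natl; ring.
Qed.

Lemma sinD2pi_int (x : R) (k l : nat) :
  sin (x + (k%:R - l%:R) * (pi *+ 2)) = sin x.
Proof.
rewrite -(periodicn (@sinD2pi R) l) -[RHS](periodicn (@sinD2pi R) k).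
congr sin; rewrite -[_ *+ 2 *+ l]mulr_natl -[_ *+ 2 *+ k]mulr_natl; ring.
Qed.

(** With [z = cos x + i sin x], the two sums are the real and imaginary parts
    of a geometric sum and [2 * (1 - cos x) = |1 - z|^2], so that the left-hand
    side is [|1 - z^n|^2 / 2]. *)
Lemma dirichlet_kernel_bound (x : R) (n : nat) :
  (1 - cos x) * ((\sum_(k < n) cos (k%:R * x)) ^+ 2 +
                 (\sum_(k < n) sin (k%:R * x)) ^+ 2) <= 2.
Proof.
set C := \sum_(k < n) cos _; set S := \sum_(k < n) sin _.
(* [(1 - z) * sum_(k < n) z^k = 1 - z^n], in real and imaginary parts *)
have [re im] : (1 - cos x) * C + sin x * S = 1 - cos (n%:R * x) /\
    (1 - cos x) * S - sin x * C = - sin (n%:R * x).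
  rewrite /C /S; elim: n {C S} => [|n [IHc IHs]].
    by rewrite !big_ord0 mul0r cos0 sin0; split; ring.
  have -> : n.+1%:R * x = n%:R * x + x by rewrite -[n.+1%:R]natr1 mulrDl mul1r.
  rewrite !big_ord_recr/= cosD sinD; split.
    by move: IHc; set c := cos (_ * x); set s := sin (_ * x) => IHc; nra.
  by move: IHs; set c := cos (_ * x); set s := sin (_ * x) => IHs; nra.
have := cos2Dsin2 x; have := cos2Dsin2 (n%:R * x); have := cos_geN1 (n%:R * x).
move: re im; set c := cos x; set s := sin x; set c' := cos _; set s' := sin _.
move=> re im c'N1 cs' cs.
suff : (1 - c) *+ 2 * (C ^+ 2 + S ^+ 2) = (1 - c') *+ 2.
  by rewrite mulrnAl; set X := (_ * _ : R) => H; lra.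
have -> : (1 - c) *+ 2 * (C ^+ 2 + S ^+ 2) =
    ((1 - c) * C + s * S) ^+ 2 + ((1 - c) * S - s * C) ^+ 2.
  rewrite (_ : (1 - c) *+ 2 = (1 - c) ^+ 2 + s ^+ 2); first by ring.
  by rewrite sqrrB -addrA cs; ring.
by rewrite re im; nra.
Qed.

End trigonometric_modes.

(** * Periodic resolvents and orthogonality *)

Section periodic_resolvent_theory.
Context (R : realType) (beta M : R).
Implicit Types h u : R -> R.
Local Notation resolvent := (periodic_resolvent beta M).

Lemma periodic_resolventD h1 u1 h2 u2 : resolvent h1 u1 -> resolvent h2 u2 ->
  resolvent (fun t => h1 t + h2 t) (fun t => u1 t + u2 t).
Proof.
move=> [per1 d1 dd1 c1 e1] [per2 d2 dd2 c2 e2].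
have D1 : derive1 (fun t => u1 t + u2 t) = fun t => derive1 u1 t + derive1 u2 t.
  by apply/funext => t; rewrite !derive1E deriveD.
have D2 : derive1n 2 (fun t => u1 t + u2 t) =
    fun t => derive1n 2 u1 t + derive1n 2 u2 t.
  apply/funext => t; rewrite /= D1 derive1E (deriveD (dd1 t) (dd2 t)).
  by rewrite -!derive1E.
split.
- by move=> t; rewrite per1 per2.
- by move=> t; exact: derivableD.
- by move=> t; rewrite D1; exact: derivableD.
- by rewrite D2 => t; apply: continuousD; [exact: c1|exact: c2].
- move=> t; rewrite D2 e1 e2.
  by move: (derive1n 2 u1 t) (derive1n 2 u2 t) => x y; ring.
Qed.

Lemma periodic_resolvent0 : resolvent (fun=> 0) (fun=> 0).
Proof.
have D1 : derive1 (fun=> 0 : R) = fun=> 0.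
  by apply/funext => t; rewrite derive1E derive_cst.
split => //=.
- by move=> t; rewrite D1.
- by rewrite D1 D1 => t; exact: cst_continuous.
- by move=> t; rewrite D1 D1; ring.
Qed.

Lemma periodic_resolvent_sum (I : Type) (r : seq I) (h u : I -> R -> R) :
  (forall i, resolvent (h i) (u i)) ->
  resolvent (fun t => \sum_(i <- r) h i t) (fun t => \sum_(i <- r) u i t).
Proof.
move=> hu; elim: r => [|i r IH].
  under eq_fun do rewrite big_nil.
  under [X in resolvent _ X]eq_fun do rewrite big_nil.
  exact: periodic_resolvent0.
under eq_fun do rewrite big_cons.
under [X in resolvent _ X]eq_fun do rewrite big_cons.
exact: periodic_resolventD.
Qed.

Lemma periodic_resolvent_cos (c p a : R) : 0 < M ->
  (forall x, cos (x + p * beta) = cos x) ->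
  resolvent (fun t => c * cos (p * (t - a)))
            (fun t => c / (1 + M * p ^+ 2) * cos (p * (t - a))).
Proof.
move=> M0 per; set d := c / _.
have p0 : 1 + M * p ^+ 2 != 0.
  by rewrite gt_eqF// ltr_wpDr// mulr_ge0 ?sqr_ge0// ltW.
have D1 (t : R) : is_derive t 1 (fun s : R => d * cos (p * (s - a)))
    (- (d * p) * sin (p * (t - a))).
  have := is_derive_cos_affine p a t => H.
  have := is_deriveZ d H.
  by move=> H2; apply: is_derive_eq; rewrite /GRing.scale/=; ring.
have E1 : derive1 (fun s => d * cos (p * (s - a))) =
    fun t => - (d * p) * sin (p * (t - a)).
  by apply/funext => t; rewrite derive1E; exact: derive_val.
have D2 (t : R) : is_derive t 1 (fun t : R => - (d * p) * sin (p * (t - a)))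
    (- (d * p ^+ 2) * cos (p * (t - a))).
  have := is_derive_sin_affine p a t => H.
  have := is_deriveZ (- (d * p)) H.
  by move=> H2; apply: is_derive_eq; rewrite /GRing.scale/=; ring.
have E2 : derive1n 2 (fun s => d * cos (p * (s - a))) =
    fun t => - (d * p ^+ 2) * cos (p * (t - a)).
  by rewrite /= E1; apply/funext => t; rewrite derive1E; exact: derive_val.
split.
- move=> t; congr (_ * _); rewrite -[RHS]per; congr cos; ring.
- by move=> t; exact: ex_derive.
- by move=> t; rewrite E1; exact: ex_derive.
- rewrite E2 => t; apply: cvgM; first exact: cvg_cst.
  exact: continuous_cos_affine.
- by move=> t; rewrite E2 /d; field.
Qed.

End periodic_resolvent_theory.

Section integral_over_period.
Context (R : realType) (beta : R).
Hypothesis beta_gt0 : 0 < beta.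
Local Notation mu := (@lebesgue_measure R).
Local Notation w := (pi *+ 2 / beta).

Lemma continuous_integrable_segment (f : R -> R) : continuous f ->
  mu.-integrable [set` `[0, beta]] (EFin \o f).
Proof.
move=> cf; apply: continuous_compact_integrable; first exact: segment_compact.
exact: continuous_subspaceT.
Qed.

Lemma measure_segment : mu [set` `[0, beta]] = beta%:E.
Proof.
by rewrite lebesgue_measure_itv/= lte_fin beta_gt0 -EFinD/= subr0.
Qed.

Lemma continuous_sum (I : Type) (r : seq I) (f : I -> R -> R) :
  (forall i, continuous (f i)) -> continuous (fun t => \sum_(i <- r) f i t).
Proof.
move=> cf; elim: r => [|i r IH] t.
  under eq_fun do rewrite big_nil.
  exact: cst_continuous.
under eq_fun do rewrite big_cons.
by apply: continuousD; [exact: cf|exact: IH].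
Qed.

Lemma Rintegral_sum_continuous (I : Type) (r : seq I) (f : I -> R -> R) :
  (forall i, continuous (f i)) ->
  \int[mu]_(t in `[0, beta]) (\sum_(i <- r) f i t) =
  \sum_(i <- r) \int[mu]_(t in `[0, beta]) f i t.
Proof.
move=> cf; elim: r => [|i r IH].
  under eq_Rintegral do rewrite big_nil.
  by rewrite Rintegral_cst// mul0r big_nil.
under eq_Rintegral do rewrite big_cons.
rewrite RintegralD//; last 2 first.
- exact: continuous_integrable_segment.
- by apply: continuous_integrable_segment; exact: continuous_sum.
by rewrite IH big_cons.
Qed.

(** Frequencies are differences of natural numbers, as they come out of the
    squared modulus of a sum of exponentials; this family is closed under
    products up to linear combination. *)
Definition osc (a : R) (k l : nat) (t : R) := cos ((k%:R - l%:R) * w * (t - a)).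

Lemma continuous_osc a k l : continuous (osc a k l).
Proof. exact: continuous_cos_affine. Qed.

Lemma wbeta : w * beta = pi *+ 2. Proof. by rewrite divfK ?gt_eqF. Qed.

Lemma integral_osc a k l :
  \int[mu]_(t in `[0, beta]) osc a k l t = beta * (k == l)%:R.
Proof.
have [->|kl] := eqVneq k l.
  under eq_Rintegral do rewrite /osc subrr !mul0r cos0.
  by rewrite Rintegral_cst// mul1r mulr1 [X in fine X]measure_segment.
rewrite mulr0; set p := (k%:R - l%:R) * w.
have p0 : p != 0.
  rewrite mulf_neq0// ?subr_eq0 ?eqr_nat// mulf_neq0 ?invr_eq0 ?gt_eqF//.
  by rewrite mulrn_wgt0 ?pi_gt0.
pose F (t : R) := p^-1 * sin (p * (t - a)).
have dF (t : R) : is_derive t 1 F (cos (p * (t - a))).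
  have := is_derive_sin_affine p a t => H.
  have := is_deriveZ p^-1 H.
  by move=> H2; apply: is_derive_eq; rewrite /GRing.scale/= mulKf.
have cF : continuous F.
  move=> t; apply: differentiable_continuous; apply/derivable1_diffP.
  exact: ex_derive.
rewrite /Rintegral (@continuous_FTC2 R _ F)//.
- rewrite -EFinB/= /F.
  suff -> : p * (beta - a) = p * (0 - a) + (k%:R - l%:R) * (pi *+ 2).
    by rewrite sinD2pi_int subrr.
  by rewrite -wbeta /p; ring.
- by apply: continuous_subspaceT; exact: continuous_osc.
- split; first by move=> t _; exact: ex_derive.
  + by apply: cvg_at_right_filter; exact: cF.
  + by apply: cvg_at_left_filter; exact: cF.
- by move=> t _; rewrite derive1E; exact: derive_val.
Qed.

Lemma oscM a k l k' l' t : osc a k l t * osc a k' l' t =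
  2^-1 * (osc a (k + k') (l + l') t + osc a (k + l') (l + k') t).
Proof.
rewrite /osc !natrD.
set x := (k%:R - l%:R) * w * (t - a); set y := (k'%:R - l'%:R) * w * (t - a).
rewrite (_ : (_ - _) * _ * _ = x + y); last by rewrite /x /y; ring.
rewrite (_ : (_ - _) * _ * _ = x - y); last by rewrite /x /y; ring.
by rewrite !cosD cosN sinN; field.
Qed.

Lemma integral_oscM_ge a k l k' l' : beta * (k == l)%:R * (k' == l')%:R <=
  \int[mu]_(t in `[0, beta]) (osc a k l t * osc a k' l' t).
Proof.
under eq_Rintegral do rewrite oscM.
have co := continuous_osc.
rewrite RintegralZl//; last first.
  by apply: continuous_integrable_segment => t; apply: continuousD; exact: co.
rewrite RintegralD//; last 2 first.
- exact: continuous_integrable_segment.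
- exact: continuous_integrable_segment.
rewrite !integral_osc -mulrDr mulrA [2^-1 * _]mulrC -!mulrA ler_pM2l//.
have [->|_] := eqVneq k l; last first.
  by rewrite mul0r mulr_ge0// addr_ge0.
have [->|_] := eqVneq k' l'; last by rewrite mulr0 mulr_ge0// addr_ge0.
by rewrite !eqxx/=; lra.
Qed.

End integral_over_period.

(** * The Fejer kernel *)

Section fejer_kernel.
Context (R : realType) (beta : R).
Hypothesis beta_gt0 : 0 < beta.
Local Notation mu := (@lebesgue_measure R).
Local Notation w := (pi *+ 2 / beta).

(** The Fejer kernel centred at [a].  The double sum, instead of the usual
    coefficients [1 - |k| / (n + 1)], exhibits it both as a squared modulus and
    as a trigonometric polynomial, on which the resolvent acts termwise. *)
Definition fejer (a : R) (n : nat) (t : R) : R :=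
  \sum_(p : 'I_n.+1 * 'I_n.+1) (beta * n.+1%:R)^-1 * osc beta a p.1 p.2 t.

Definition fejer_resolvent (M a : R) (n : nat) (t : R) : R :=
  \sum_(p : 'I_n.+1 * 'I_n.+1) (beta * n.+1%:R)^-1 /
    (1 + M * ((p.1%:R - p.2%:R) * w) ^+ 2) * osc beta a p.1 p.2 t.

Let c_gt0 n : 0 < (beta * n.+1%:R)^-1. Proof. by rewrite invr_gt0 mulr_gt0. Qed.

Lemma periodic_resolvent_fejer M a n : 0 < M ->
  periodic_resolvent beta M (fejer a n) (fejer_resolvent M a n).
Proof.
move=> M0; apply: periodic_resolvent_sum => -[k l] /=.
apply: periodic_resolvent_cos => // x.
by rewrite -mulrA wbeta// cosD2pi_int.
Qed.

Lemma continuous_fejer a n : continuous (fejer a n).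
Proof.
apply: continuous_sum => p t; apply: cvgM; first exact: cvg_cst.
exact: continuous_osc.
Qed.

Lemma sum_diagonal n :
  \sum_(p : 'I_n * 'I_n) (p.1 == p.2 :> nat)%:R = n%:R :> R.
Proof.
rewrite -(pair_bigA _ (fun i j : 'I_n => (i == j :> nat)%:R)) /=.
rewrite (eq_bigr (fun=> 1)) ?sumr_const ?card_ord// => i _.
rewrite (bigD1 i)//= eqxx big1 ?addr0// => j ji.
by rewrite val_eqE eq_sym (negPf ji).
Qed.

Lemma integral_fejer a n : \int[mu]_(t in `[0, beta]) fejer a n t = 1.
Proof.
rewrite /fejer Rintegral_sum_continuous//; last first.
  move=> p t; apply: cvgM; first exact: cvg_cst.
  exact: continuous_osc.
under eq_bigr => p _.
  rewrite RintegralZl//; last first.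
    by apply: continuous_integrable_segment; exact: continuous_osc.
  rewrite integral_osc//.
over.
rewrite -mulr_sumr -mulr_sumr sum_diagonal.
by rewrite mulVf// mulf_neq0 ?gt_eqF.
Qed.

(** Cosines of multiples of the base frequency, centred at the same point, are
    orthogonal or equal, so that no product of two of them has a negative
    integral.  The constant mode, that is the diagonal of the double sum,
    already contributes [beta^-1], because the resolvent leaves it unchanged. *)
Lemma inner_fejer_ge M a n : 0 < M ->
  beta^-1 <= inner beta (fejer a n) (fejer_resolvent M a n).
Proof.
move=> M0; set c := (beta * n.+1%:R)^-1.
pose lam (p : 'I_n.+1 * 'I_n.+1) := (1 + M * ((p.1%:R - p.2%:R) * w) ^+ 2)^-1.
have lam0 p : 0 <= lam p.
  by rewrite invr_ge0 addr_ge0// mulr_ge0 ?sqr_ge0// ltW.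
have E t : fejer a n t * fejer_resolvent M a n t =
    \sum_(p : 'I_n.+1 * 'I_n.+1) \sum_(p' : 'I_n.+1 * 'I_n.+1)
      c * c * lam p' * (osc beta a p.1 p.2 t * osc beta a p'.1 p'.2 t).
  rewrite /fejer /fejer_resolvent big_distrlr /=.
  by apply: eq_bigr => p _; apply: eq_bigr => p' _; rewrite /lam -/c; ring.
have coo (p p' : 'I_n.+1 * 'I_n.+1) : continuous
    (fun t => c * c * lam p' * (osc beta a p.1 p.2 t * osc beta a p'.1 p'.2 t)).
  move=> t; apply: cvgM; first exact: cvg_cst.
  by apply: cvgM; exact: continuous_osc.
rewrite /inner; under eq_Rintegral do rewrite E.
rewrite Rintegral_sum_continuous; last first.
  by move=> p; exact: (continuous_sum (coo p)).
under eq_bigr => p _ do rewrite (Rintegral_sum_continuous _ _ (coo p)).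
have -> : beta^-1 = \sum_(p : 'I_n.+1 * 'I_n.+1) \sum_(p' : 'I_n.+1 * 'I_n.+1)
    c * c * beta * ((p.1 == p.2 :> nat)%:R * (p'.1 == p'.2 :> nat)%:R).
  under eq_bigr => p _ do rewrite -mulr_sumr -mulr_sumr sum_diagonal.
  rewrite -mulr_sumr -mulr_suml sum_diagonal /c; field.
  by rewrite nat1r pnatr_eq0 /= lt0r_neq0.
apply: ler_sum => p _; apply: ler_sum => p' _.
rewrite RintegralZl//; last first.
  apply: continuous_integrable_segment => t.
  by apply: cvgM; exact: continuous_osc.
have [pp'|_] := eqVneq (p'.1 : nat) (p'.2 : nat); last first.
  rewrite !mulr0 mulr_ge0//; first by rewrite !mulr_ge0// ltW// c_gt0.
  apply: le_trans (integral_oscM_ge beta_gt0 a p.1 p.2 p'.1 p'.2).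
  by rewrite !mulr_ge0// ltW.
have -> : lam p' = 1 by rewrite /lam pp' subrr mul0r expr0n/= mulr0 addr0 invr1.
have := integral_oscM_ge beta_gt0 a p.1 p.2 p'.1 p'.2.
rewrite pp' eqxx !mulr1 -!mulrA => H.
by rewrite !ler_pM2l// c_gt0.
Qed.

Lemma fejer_square a n t : fejer a n t = (beta * n.+1%:R)^-1 *
  ((\sum_(k < n.+1) cos (k%:R * (w * (t - a)))) ^+ 2 +
   (\sum_(k < n.+1) sin (k%:R * (w * (t - a)))) ^+ 2).
Proof.
rewrite /fejer -mulr_sumr; congr (_ * _).
rewrite !expr2 !big_distrlr/= -big_split/=.
rewrite -(pair_bigA _ (fun k l : 'I_n.+1 => osc beta a k l t)) /=.
apply: eq_bigr => k _; rewrite -big_split/=; apply: eq_bigr => l _.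
rewrite /osc mulrBl mulrBl -!mulrA cosB; ring.
Qed.

Lemma fejer_ge0 a n t : 0 <= fejer a n t.
Proof.
by rewrite fejer_square mulr_ge0 ?(ltW (c_gt0 n))// addr_ge0// sqr_ge0.
Qed.

Lemma fejer_concentration a n t :
  (1 - cos (w * (t - a))) * fejer a n t <= 2 / (beta * n.+1%:R).
Proof.
rewrite fejer_square mulrCA mulrC ler_pM2r ?c_gt0//.
exact: dirichlet_kernel_bound.
Qed.

End fejer_kernel.

(** * Recovering the value of a loop from its Fejer averages *)

Section fejer_approximation.
Context (R : realType) (beta : R).
Hypothesis beta_gt0 : 0 < beta.
Local Notation mu := (@lebesgue_measure R).
Local Notation w := (pi *+ 2 / beta).

Lemma cos_lt1 (x : R) : 0 < x < pi *+ 2 -> cos x < 1.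
Proof.
move=> /andP[x0 x2]; rewrite (_ : x = (x / 2) *+ 2); last first.
  by rewrite -mulr_natr divfK.
rewrite cos_mulr2n cos2sin2.
have : 0 < sin (x / 2).
  by rewrite sin_gt0_pi// divr_gt0//= ltr_pdivrMr// mulr_natr.
by move=> s0; have := exprn_gt0 2 s0; lra.
Qed.

(** Korovkin's device: away from [a], a multiple of [1 - cos (w * (t - a))]
    dominates the oscillation of [q], and this test function is one whose
    integral against the Fejer kernel tends to zero. *)
Lemma korovkin_bound (q : R -> R) (a e : R) : 0 < a < beta ->
  {within [set` `[0, beta]], continuous q} -> 0 < e ->
  exists2 C : R, 0 <= C & forall t, t \in `[0, beta] ->
    `|q a - q t| <= e + C * (1 - cos (w * (t - a))).
Proof.
move=> /andP[a0 ab] qc e0.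
have w0 : 0 < w by rewrite divr_gt0// mulrn_wgt0// pi_gt0.
have aD : a \in `]0, beta[ by rewrite in_itv/= a0.
have qca : {for a, continuous q} := within_continuous_continuous beta_gt0 qc aD.
have [d /= d0 near_a] : \forall t \near a, `|q a - q t| < e.
  by have /cvgrPdist_lt := qca; apply.
have [B _ qB] : exists2 B : R, 0 <= B &
    forall t, t \in `[0, beta] -> `|q a - q t| <= B.
  have : {within [set` `[0, beta]], continuous (fun t => `|q a - q t|)}.
    move=> t; apply: cvg_norm; apply: cvgB; first exact: cvg_cst.
    exact: qc.
  move=> /(EVT_max (ltW beta_gt0))[c cD cmax].
  by exists `|q a - q c|.
pose L := Num.max a (beta - a).
have L_lt : L < beta by rewrite gt_max ab/=; lra.
have tL t : t \in `[0, beta] -> `|a - t| <= L.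
  rewrite in_itv/= => /andP[t0 tb]; rewrite ler_norml le_max.
  rewrite lerNl le_max; apply/andP; split; apply/orP; [right|left]; lra.
have cosw t : cos (w * (t - a)) = cos (w * `|a - t|).
  have [at0|at0] := lerP 0 (a - t).
    by rewrite -cosN -mulrN opprB ger0_norm.
  by rewrite ltr0_norm// opprB.
have [Ld|dL] := ltP L d.
  exists 0 => // t tD; rewrite mul0r addr0 ltW//; apply: near_a => /=.
  exact: le_lt_trans (tL _ tD) Ld.
have /(EVT_min dL)[c cdL cmin] :
    {within [set` `[d, L]], continuous (fun x => 1 - cos (w * x))}.
  apply: continuous_subspaceT => x; apply: cvgB; first exact: cvg_cst.
  have := @continuous_cos_affine R w 0 x.
  by under eq_fun do rewrite subr0.
set m := 1 - cos (w * c) in cmin.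
have m0 : 0 < m.
  move: cdL; rewrite in_itv/= => /andP[dc cL].
  rewrite subr_gt0 cos_lt1// mulr_gt0//=; last exact: lt_le_trans dc.
  by rewrite -[X in _ < X](wbeta beta_gt0) ltr_pM2l// (le_lt_trans cL).
have B0 : 0 <= B by apply: le_trans (qB a _); rewrite // in_itv/= !ltW.
exists (B / m); first by rewrite divr_ge0// ltW.
move=> t tD; have [atd|dat] := ltP `|a - t| d.
  rewrite (le_trans (ltW (near_a _ atd)))// lerDl mulr_ge0//.
    by rewrite divr_ge0// ltW.
apply: (le_trans (qB _ tD)); apply: ler_wpDl; first exact: ltW.
rewrite mulrAC ler_pdivlMr// ler_wpM2l// cosw.
by apply: cmin; rewrite in_itv/= dat tL.
Qed.

Lemma inner_fejer_cvg (q : R -> R) (a : R) : 0 < a < beta ->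
  {within [set` `[0, beta]], continuous q} ->
  inner beta (fejer beta a n) q @[n --> \oo] --> q a.
Proof.
move=> aD qc.
have int_within (f : R -> R) : {within [set` `[0, beta]], continuous f} ->
    mu.-integrable [set` `[0, beta]] (EFin \o f).
  move=> cf; apply: continuous_compact_integrable => //.
  exact: segment_compact.
have cwithin (f : R -> R) : continuous f ->
    {within [set` `[0, beta]], continuous f}.
  exact: continuous_subspaceT.
apply/cvgrPdist_le => e e0.
have e2 : 0 < e / 2 by rewrite divr_gt0.
have [C C0 HC] := korovkin_bound aD qc e2.
have cfq n : {within [set` `[0, beta]],
    continuous (fun t => fejer beta a n t * q t)}.
  move=> t; apply: cvgM; last exact: qc.
  by apply: cwithin; exact: continuous_fejer.
have cfd n : {within [set` `[0, beta]],
    continuous (fun t => fejer beta a n t * (q a - q t))}.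
  move=> t; apply: cvgM; first by apply: cwithin; exact: continuous_fejer.
  by apply: cvgB; [exact: cvg_cst|exact: qc].
have cF n := @continuous_fejer R beta a n.
have bound n : `|q a - inner beta (fejer beta a n) q| <=
    e / 2 + C * 2 / n.+1%:R.
  have -> : q a - inner beta (fejer beta a n) q =
      \int[mu]_(t in `[0, beta]) (fejer beta a n t * (q a - q t)).
    under eq_Rintegral do rewrite mulrBr.
    rewrite RintegralB//; last 2 first.
    - apply: int_within; apply: cwithin => t.
      by apply: cvgM; [exact: cF|exact: cvg_cst].
    - exact: int_within.
    rewrite RintegralZr//; last by apply: int_within; exact: cwithin.
    by rewrite integral_fejer// mul1r.
  apply: le_trans (le_normr_Rintegral _ _) _ => //; first exact: int_within.
  have -> : e / 2 + C * 2 / n.+1%:R = \int[mu]_(t in `[0, beta])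
      (fejer beta a n t * (e / 2) + C * 2 / (beta * n.+1%:R)).
    rewrite RintegralD//; last 2 first.
    - apply: int_within; apply: cwithin => t.
      by apply: cvgM; [exact: cF|exact: cvg_cst].
    - by apply: int_within; apply: cwithin => t; exact: cvg_cst.
    rewrite RintegralZr//; last by apply: int_within; exact: cwithin.
    rewrite integral_fejer// Rintegral_cst// [X in fine X]measure_segment//=.
    by field; rewrite nat1r pnatr_eq0 /= lt0r_neq0.
  apply: le_Rintegral => //.
  - by apply: int_within => t; apply: cvg_norm; exact: cfd.
  - apply: int_within; apply: cwithin => t; apply: cvgD; last exact: cvg_cst.
    by apply: cvgM; [exact: cF|exact: cvg_cst].
  - move=> t tD; rewrite normrM ger0_norm ?fejer_ge0//.
    apply: le_trans (ler_wpM2l (fejer_ge0 beta_gt0 a n t) (HC t tD)) _.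
    rewrite mulrDr lerD2l mulrCA -[X in _ <= X]mulrA ler_wpM2l// mulrC.
    exact: fejer_concentration.
have : (fun n => e / 2 + C * 2 / n.+1%:R) @ \oo --> e / 2 + C * 2 * 0.
  apply: cvgD; first exact: cvg_cst.
  by apply: cvgM; [exact: cvg_cst|exact: cvg_harmonic].
rewrite mulr0 addr0 => /cvgrPdist_lt/(_ _ e2).
apply: filterS => n H; apply: le_trans (bound n) _.
move: H => /=; set x := C * 2 / _; rewrite ltr_norml => /andP[+ _]; lra.
Qed.

End fejer_approximation.

(** * Absolute continuity of the one-time laws *)

Section occupation.
Context (R : realType) (beta M : R) (pi0 : probability (loop_space beta) R).
Hypotheses (beta_gt0 : 0 < beta) (M_gt0 : 0 < M).
Hypothesis free : is_free_loop_measure M pi0.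
Local Notation mu := (@lebesgue_measure R).
Local Notation D := [set` `[0, beta]].
Local Notation DX :=
  ([set` `[0, beta]] `*` setT : set (measurableTypeR R * loop_space beta)).
Local Open Scope ereal_scope.

(** The maximum of the Gaussian density of variance [beta^-1]. *)
Definition peak_bound : R := (Num.sqrt (beta^-1 * pi *+ 2))^-1.

Let peak_bound_gt0 : (0 < peak_bound)%R.
Proof.
by rewrite invr_gt0 sqrtr_gt0 mulrn_wgt0// mulr_gt0 ?invr_gt0 ?pi_gt0.
Qed.

Lemma normal_prob_le_length (v : R) (U : set R) : (beta^-1 <= v)%R ->
  measurable U ->
  normal_prob 0 (Num.sqrt v) U <= peak_bound%:E * mu U.
Proof.
move=> bv mU.
have b0 : (0 < beta^-1)%R by rewrite invr_gt0.
have v0 : (0 < v)%R by exact: lt_le_trans bv.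
have s0 : (Num.sqrt v != 0)%R by rewrite sqrtr_eq0 -ltNge.
have -> : peak_bound%:E * mu U = \int[mu]_(x in U) peak_bound%:E.
  by rewrite integral_cst.
apply: ge0_le_integral => //.
- by move=> x _; rewrite lee_fin normal_pdf_ge0.
- apply/measurable_EFinP; apply: measurable_funTS.
  exact: measurable_normal_pdf.
move=> x _; rewrite lee_fin (le_trans (normal_pdf_ub _ _ s0))//.
rewrite /normal_peak /peak_bound sqr_sqrtr ?(ltW v0)//.
rewrite lef_pV2 ?posrE ?sqrtr_gt0 ?mulrn_wgt0 ?mulr_gt0 ?pi_gt0//.
by rewrite ler_wsqrtr// lerMn2r/= ler_wpM2r ?pi_ge0.
Qed.

Lemma measurable_inner (h : R -> R) : continuous h ->
  measurable_fun [set: loop_space beta]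
    (fun q : loop_space beta => inner beta h q).
Proof.
move=> ch.
pose F (p : measurableTypeR R * loop_space beta) : R := (h p.1 * p.2 p.1)%R.
have mF : measurable_fun DX F; last exact: (measurable_time_integral mF).
apply: measurable_funM; last exact: measurable_path.
apply: measurable_funTS; apply: measurableT_comp; last exact: measurable_fst.
exact: continuous_measurable_fun.
Qed.

(** The Fejer averages of the loop are Gaussian with variance at least
    [beta^-1], the contribution of the constant mode; an open set that contains
    the value of the loop at [a] contains these averages eventually. *)
Lemma one_time_law_open (a : R) (U : set R) : (0 < a < beta)%R -> open U ->
  pi0 [set q : loop_space beta | U (q a)] <= peak_bound%:E * mu U.
Proof.
move=> aD oU; have mU := open_measurable oU.
pose X n (q : loop_space beta) := inner beta (fejer beta a n) q.
pose E n := X n @^-1` U.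
have mE n : measurable (E n).
  rewrite -[E n]setTI; apply: measurable_inner => //.
  exact: continuous_fejer.
have PE n : pi0 (E n) <= peak_bound%:E * mu U.
  have v := inner_fejer_ge beta_gt0 a n M_gt0.
  have := free (periodic_resolvent_fejer beta_gt0 a n M_gt0) _ mU.
  rewrite /pushforward => ->; first exact: normal_prob_le_length.
  by apply: lt_le_trans v; rewrite invr_gt0.
pose F N := \bigcap_(n in [set n | (N <= n)%N]) E n.
have mF N : measurable (F N) by apply: bigcap_measurable => //; exists N => /=.
have mUF : measurable (\bigcup_N F N) by exact: bigcup_measurable.
have ndF : {homo F : n m / (n <= m)%N >-> (n <= m)%O}.
  move=> n m nm; apply/subsetPset => q Fq k /= mk; apply: Fq => /=.
  exact: leq_trans mk.
have cF := nondecreasing_cvg_mu (mu := pi0) mF mUF ndF.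
apply: (@le_trans _ _ (pi0 (\bigcup_N F N))).
  apply: le_measure; rewrite ?inE//.
    by rewrite -[X in measurable X]setTI; exact: measurable_loop_eval.
  move=> q /= Uqa.
  have := inner_fejer_cvg beta_gt0 aD (@loop_continuous _ _ q).
  move=> /(_ U (open_nbhs_nbhs (conj oU Uqa))) [N _ HN].
  by exists N => // n /= Nn; exact: HN.
rewrite -(cvg_lim _ cF)//; apply: lime_le.
  by apply/cvg_ex; eexists; exact: cF.
apply: nearW => N; apply: le_trans (PE N).
by apply: le_measure; rewrite ?inE// => q; apply => /=.
Qed.

(** Outer regularity turns the bound on open sets into absolute continuity. *)
Lemma one_time_law_null (a : R) (N : set R) : (0 < a < beta)%R ->
  measurable N -> mu N = 0 -> pi0 [set q : loop_space beta | N (q a)] = 0.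
Proof.
move=> aD mN N0; apply/eqP; rewrite eq_le measure_ge0 andbT.
apply/lee_addgt0Pr => e e0; rewrite add0e.
have ep : (0 < e / peak_bound)%R by rewrite divr_gt0.
have [|U [oU NU UN]] := lebesgue_regularity_outer mN _ ep.
  by rewrite [X in X < _]N0 ltry.
have mU := open_measurable oU.
have mev B : measurable B -> measurable [set q : loop_space beta | B (q a)].
  by move=> mB; rewrite -[X in measurable X]setTI; exact: measurable_loop_eval.
apply: (@le_trans _ _ (pi0 [set q : loop_space beta | U (q a)])).
  apply: le_measure; rewrite ?inE; [exact: mev|exact: mev|].
  by move=> q; exact: NU.
apply: le_trans (one_time_law_open aD oU) _.
have -> : mu U = mu (U `\` N).
  have {1}-> : U = (U `\` N) `|` N by rewrite setUC setDUK.
  by apply: measureU0 => //; exact: measurableD.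
apply: (@le_trans _ _ (peak_bound%:E * (e / peak_bound)%:E)).
  by rewrite lee_pmul2l ?lte_fin// ltW.
by rewrite -EFinM lee_fin mulrC divfK// gt_eqF.
Qed.

(** Fubini's theorem applied to the time spent in a Lebesgue null set.  This is
    what makes path integrals of classes of potentials depend on essential
    bounds only. *)
Lemma ae_along_paths (P : R -> Prop) : (\forall x \ae mu, P x) ->
  \forall q \ae pi0, \forall t \ae mu, t \in `[0, beta]%R ->
    P ((q : loop_space beta) t).
Proof.
move=> [N [mN N0 PN]].
pose g (p : measurableTypeR R * loop_space beta) : R := \1_N (p.2 p.1).
have mg : measurable_fun DX g.
  by apply: (measurable_path_comp beta_gt0 (f := \1_N)).
pose f := (EFin \o g) \_ DX.
have mDX : measurable DX by exact: measurableX.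
have mf : measurable_fun setT f.
  by apply: (measurable_restrictT _ mDX).1; exact/measurable_EFinP.
have f0 p : 0 <= f p by rewrite /f /patch; case: ifP => // _; rewrite lee_fin.
have sec1 q : measurable_fun setT (fun t : measurableTypeR R => f (t, q)).
  by apply: measurableT_comp => //; exact: pair2_measurable.
have F0 t : (0 < t < beta)%R -> \int[pi0]_q f (t, q) = 0.
  move=> tD; rewrite -(one_time_law_null tD mN N0).
  have -> : [set q : loop_space beta | N (q t)] =
      [set q : loop_space beta | N (q t)] `&` setT by rewrite setIT.
  rewrite -integral_indic//; last first.
    by rewrite -[X in measurable X]setTI; exact: measurable_loop_eval.
  apply: eq_integral => q _; rewrite /f /patch mem_set//=.
  by split => //=; rewrite in_itv/= !ltW//; case/andP: tD.
have : \int[pi0]_q \int[mu]_t f (t, q) = 0.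
  rewrite -fubini_tonelli//.
  rewrite (eq_integral (fun t => `|\int[pi0]_q f (t, q)|)); last first.
    by move=> t _; rewrite gee0_abs// integral_ge0.
  apply/ae_eq_integral_abs => //; first exact: measurable_fun_fubini_tonelli_F.
  (* the law of [q t] is under control only at interior times *)
  exists ([set 0%R] `|` [set beta]); split.
  - by apply: measurableU; exact: measurable_set1.
  - transitivity (mu [set 0%R]); last exact: lebesgue_measure_set1.
    apply: measureU0; [exact: measurable_set1|exact: measurable_set1|].
    exact: lebesgue_measure_set1.
  move=> t /= /not_implyP[_ Ht]; have [tD|tD] := boolP (0 < t < beta)%R.
    by case: Ht; exact: F0.
  have [tt|tt] := boolP (t \in `[0, beta]%R); last first.
    case: Ht; apply: integral0_eq => q _; rewrite /f /patch.
    by case: ifPn => // /set_mem[/= tt']; rewrite tt' in tt.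
  move: tt tD; rewrite in_itv/= !lt_neqAle => /andP[-> ->]; rewrite !andbT.
  by rewrite negb_and !negbK => /orP[/eqP <-|/eqP ->]; [left|right].
rewrite (eq_integral (fun q => `|\int[mu]_t f (t, q)|)); last first.
  by move=> q _; rewrite gee0_abs// integral_ge0.
move/(ae_eq_integral_abs _ _ _).1 => /(_ measurableT).
move=> /(_ (measurable_fun_fubini_tonelli_G _ mf f0)).
apply: filterS => q /(_ I) fq0.
have : \int[mu]_t `|f (t, q)| = 0.
  by rewrite -[RHS]fq0; apply: eq_integral => t _; rewrite gee0_abs.
move/(ae_eq_integral_abs _ measurableT (sec1 q)).1.
apply: filterS => t /(_ I) ftq tD; apply: contrapT => nP.
have Nqt : N (q t) by exact: PN.
move: ftq; rewrite /f /patch mem_set//= /g indicE mem_set//.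
by move=> /eqP; rewrite onee_eq0.
Qed.

End occupation.

(** * Gibbs measures as functions of the potential *)

Section action_estimates.
Context (R : realType) (beta M : R) (pi0 : probability (loop_space beta) R).
Hypotheses (beta_gt0 : 0 < beta) (M_gt0 : 0 < M).
Hypothesis free : is_free_loop_measure M pi0.
Local Notation mu := (@lebesgue_measure R).
Local Notation D := [set` `[0, beta]].
Implicit Types (V : W1_space R) (q : loop_space beta).

Lemma ae_bounded_integral (f : R -> R) (K : R) : 0 <= K ->
  measurable_fun D f -> (\forall t \ae mu, t \in `[0, beta] -> `|f t| <= K) ->
  mu.-integrable D (EFin \o f) /\
  `|\int[mu]_(t in `[0, beta]) f t| <= K * beta.
Proof.
move=> K0 mf fK.
have mfE : measurable_fun D (EFin \o f) by exact/measurable_EFinP.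
have le : (\int[mu]_(t in D) `|(EFin \o f) t| <= (K * beta)%:E)%E.
  rewrite EFinM -(measure_segment beta_gt0) -integral_cst//.
  by apply: ae_ge0_le_integral => //; exact: measurableT_comp.
have intf : mu.-integrable D (EFin \o f).
  by apply/integrableP; split => //; rewrite (le_lt_trans le)// ltry.
split => //; rewrite -lee_fin EFin_normr_Rintegral//.
exact: le_trans (le_abse_integral _ _ _) le.
Qed.

Lemma measurable_perturbation V : measurable_fun setT (perturbation V).
Proof.
apply: measurable_funB; last exact: measurable_harmonic.
exact: (measurable_funPT (repr (W1_fun V))).
Qed.

Lemma lebesgue_measureT_gt0 : (0 < mu [set: R])%E.
Proof. by rewrite -set_itvNyy lebesgue_measure_itv ltey. Qed.

Lemma perturbation_bounded V :
  exists2 K : R, 0 <= K & \forall x \ae mu, `|perturbation V x| <= K.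
Proof.
have := W1_Loo V; rewrite /finite_norm unlock /Lnorm lebesgue_measureT_gt0.
set s := ess_sup _ _ => sy.
have := ess_sup_ge mu (abse \o (EFin \o perturbation V)).
rewrite -/s; case: s sy => [K|//|] _ H.
  exists (Num.max K 0); first by rewrite le_max lexx orbT.
  by apply: filterS H => x /=; rewrite lee_fin le_max => ->.
by exists 0 => //; apply: filterS H => x.
Qed.

Lemma W1dist_ae V V' (e : R) : (W1dist V V' < e%:E)%E ->
  \forall x \ae mu, `|perturbation V x - perturbation V' x| <= e.
Proof.
rewrite /W1dist /W1norm => He.
have : ('N[mu]_(+oo)[EFin \o (fun x => perturbation V x - perturbation V' x)%R]
    <= e%:E)%E.
  by apply: le_trans (ltW He); rewrite leeDr// Lnorm_ge0.
rewrite unlock /Lnorm lebesgue_measureT_gt0 => /ess_supP.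
by apply: filterS => x /=; rewrite lee_fin.
Qed.

Definition action V q : R := \int[mu]_(t in `[0, beta]) perturbation V (q t).

Lemma measurable_action V : measurable_fun setT (action V).
Proof.
apply: (measurable_time_integral (measurable_path_comp beta_gt0 _)).
exact: measurable_perturbation.
Qed.

Lemma measurable_perturbation_path V q :
  measurable_fun D (fun t => perturbation V (q t)).
Proof.
have := measurable_path_comp beta_gt0 (measurable_perturbation V).
by move/(measurable_section q).
Qed.

Lemma perturbation_path_integrable V : \forall q \ae pi0,
  mu.-integrable D
    (EFin \o (fun t => perturbation V ((q : loop_space beta) t))).
Proof.
have [K K0 VK] := perturbation_bounded V.
have := ae_along_paths beta_gt0 M_gt0 free VK.
apply: filterS => q H.
by have [] := ae_bounded_integral K0 (measurable_perturbation_path V q) H.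
Qed.

Lemma action_bounded V : exists K, \forall q \ae pi0, `|action V q| <= K.
Proof.
have [K K0 VK] := perturbation_bounded V; exists (K * beta).
have := ae_along_paths beta_gt0 M_gt0 free VK.
apply: filterS => q H.
by have [] := ae_bounded_integral K0 (measurable_perturbation_path V q) H.
Qed.

Lemma action_close V V' (e : R) : (W1dist V V' < e%:E)%E ->
  \forall q \ae pi0, `|action V q - action V' q| <= e * beta.
Proof.
move=> /W1dist_ae VV'.
(* an almost sure bound on an absolute value is nonnegative, as the line is
   not a null set *)
have e0 : 0 <= e.
  have [//|e0] := leP 0 e.
  case: VV' => N [mN N0 sN]; have NT : N = setT.
    rewrite -subTset => x _; apply: sN => /= H.
    by have := le_lt_trans H e0; rewrite ltNge normr_ge0.
  have := lebesgue_measureT_gt0.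
  by rewrite -[X in (_ < mu X)%E]NT [X in (_ < X)%E]N0 ltxx.
have H1 := perturbation_path_integrable V.
have H2 := perturbation_path_integrable V'.
have H3 := ae_along_paths beta_gt0 M_gt0 free VV'.
apply: filterS3 H1 H2 H3 => q i1 i2 H.
rewrite /action -RintegralB//.
have [] // := @ae_bounded_integral
  (fun t => perturbation V (q t) - perturbation V' (q t)) e e0.
by apply: measurable_funB; exact: measurable_perturbation_path.
Qed.

Definition gibbs_density V q : R := expR (- action V q).

Lemma weight_gibbs V : weight pi0 (gibbs_density V).
Proof.
split.
- apply: measurableT_comp => //; apply: measurableT_comp => //.
  exact: measurable_action.
- by move=> q; exact: expR_gt0.
- have [K H] := action_bounded V; exists (expR K).
  apply: filterS H => q; rewrite ler_norml => /andP[H _].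
  by rewrite ler_expR lerNl.
Qed.

Lemma gibbs_tilt V : gibbs pi0 V = tilt pi0 (gibbs_density V).
Proof. by []. Qed.

Lemma gibbs_close V V' (e : R) B : measurable B -> (W1dist V' V < e%:E)%E ->
  (gibbs pi0 V B <= (expR (e * beta) * expR (e * beta))%:E * gibbs pi0 V' B)%E.
Proof.
move=> mB /action_close VV'; rewrite !gibbs_tilt.
apply: tilt_le_tilt => //; first exact: weight_gibbs.
- exact: weight_gibbs.
- apply: filterS VV' => q; rewrite ler_norml => /andP[H1 H2].
  by rewrite -expRD ler_expR; lra.
- apply: filterS VV' => q; rewrite ler_norml => /andP[H1 H2].
  by rewrite -expRD ler_expR; lra.
Qed.

Definition gibbs_measure V : probability (loop_space beta) R :=
  mtilt (weight_gibbs V).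

(** The comparison of Gibbs measures makes [V |-> gibbs pi0 V B] lower
    semicontinuous, which is all that measurability requires. *)
Lemma measurable_gibbs : measurable_family gibbs_measure.
Proof.
move=> B mB; apply: (measurability _ (ErealGenOInfty.measurableE R)).
move=> _ [_ [x ->] <-]; rewrite setTI; apply: sub_sigma_algebra.
have -> : (fun V => gibbs_measure V B) @^-1` [set` `]x%:E, +oo[] =
    [set V | (x%:E < gibbs_measure V B)%E].
  by apply/funext => V; rewrite /preimage /mkset in_itv andbT.
move=> V xV; rewrite /mkset in xV.
have gfin V' : gibbs_measure V' B \is a fin_num by exact: fin_num_measure.
set g := fine (gibbs_measure V B).
have gE : gibbs_measure V B = g%:E by rewrite fineK.
have g0 : 0 <= g by rewrite fine_ge0.
have g1 : g <= 1 by rewrite -lee_fin -gE probability_le1.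
rewrite gE lte_fin in xV.
(* chosen so that [1 - 2 * e * beta], a lower bound of the ratio of the two
   probabilities, maps [g] above [x] *)
pose e := (g - x) / (4 * beta).
exists e; first by rewrite divr_gt0 ?mulr_gt0// subr_gt0.
move=> V' VV'; rewrite /mkset -(fineK (gfin V')) lte_fin.
have : (gibbs_measure V B <= (expR (e * beta) * expR (e * beta))%:E *
    gibbs_measure V' B)%E by exact: (gibbs_close mB VV').
rewrite gE -(fineK (gfin V')) -EFinM lee_fin -expRD => H.
apply: (@lt_le_trans _ _ (expR (- (e * beta + e * beta)) * g)); last first.
  by rewrite expRN mulrC ler_pdivrMr ?expR_gt0// mulrC.
have ebeta : e * beta + e * beta = (g - x) / 2.
  by rewrite /e; field; rewrite lt0r_neq0.
rewrite ebeta; have := expR_ge1Dx (- ((g - x) / 2)) => H2.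
apply: (@lt_le_trans _ _ ((1 - (g - x) / 2) * g)); last by rewrite ler_wpM2r.
by nra.
Qed.

End action_estimates.

(** * Posteriors *)

Section euclidean_norm.
Context (R : realType) (n : nat).
Implicit Types (u v : 'cV[R]_n) (S : 'M[R]_n).

Lemma norm2_ge0 v : 0 <= norm2 v. Proof. exact: sqrtr_ge0. Qed.

Lemma norm2_sqr v : norm2 v ^+ 2 = \sum_i v i 0 ^+ 2.
Proof. by rewrite sqr_sqrtr// sumr_ge0// => i _; exact: sqr_ge0. Qed.

Lemma coord_le_norm2 v i : `|v i 0| <= norm2 v.
Proof.
rewrite -sqrtr_sqr ler_wsqrtr// (bigD1 i)//= lerDl.
by rewrite sumr_ge0// => j _; exact: sqr_ge0.
Qed.

Lemma subv_coord u v i : (u - v) i 0 = u i 0 - v i 0.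
Proof. by rewrite !mxE. Qed.

Lemma norm2BC u v : norm2 (u - v) = norm2 (v - u).
Proof.
congr Num.sqrt; apply: eq_bigr => i _; rewrite !subv_coord; ring.
Qed.

Lemma norm2B_lt u v (r : R) : norm2 u < r -> norm2 v < r ->
  norm2 (u - v) <= 2 * r.
Proof.
move=> ur vr; have u0 := norm2_ge0 u; have v0 := norm2_ge0 v.
rewrite -(@ler_pXn2r _ 2)// ?nnegrE ?norm2_ge0//; last first.
  by rewrite mulr_ge0// (le_trans u0)// ltW.
apply: (@le_trans _ _ (2 * norm2 u ^+ 2 + 2 * norm2 v ^+ 2)); last by nra.
rewrite !norm2_sqr !mulr_sumr -big_split/=; apply: ler_sum => i _.
by rewrite !mxE; have := sqr_ge0 (u i 0 + v i 0); nra.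
Qed.

Lemma mulmx_coord_le S v i (K : R) : (forall j, `|v j 0| <= K) ->
  `|(S *m v) i 0| <= (\sum_j `|S i j|) * K.
Proof.
move=> vK; rewrite mxE (le_trans (ler_norm_sum _ _ _))// mulr_suml.
by apply: ler_sum => j _; rewrite normrM ler_wpM2l.
Qed.

Definition mxdot S u v : R := \sum_i (S *m u) i 0 * (S *m v) i 0.

Lemma mxdotBl S u1 u2 v : mxdot S (u1 - u2) v = mxdot S u1 v - mxdot S u2 v.
Proof.
rewrite /mxdot -sumrB; apply: eq_bigr => i _.
by rewrite mulmxBr subv_coord mulrBl.
Qed.

Lemma mxdot_le S u v (K : R) : (forall j, `|v j 0| <= K) ->
  `|mxdot S u v| <= (\sum_i (\sum_j `|S i j|) ^+ 2) * K * norm2 u.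
Proof.
move=> vK; rewrite (le_trans (ler_norm_sum _ _ _))// -mulrA mulr_suml.
apply: ler_sum => i _; rewrite normrM.
apply: le_trans (ler_pM _ _ (mulmx_coord_le S i (coord_le_norm2 u))
  (mulmx_coord_le S i vK)) _ => //.
set s := \sum_j _.
by rewrite (_ : s * norm2 u * (s * K) = s ^+ 2 * (K * norm2 u))//; ring.
Qed.

End euclidean_norm.

Section posterior_comparison.
Context (R : realType) (beta M : R) (n : nat).
Context (pi0 : probability (loop_space beta) R).
Hypotheses (beta_gt0 : 0 < beta) (M_gt0 : 0 < M).
Hypothesis free : is_free_loop_measure M pi0.
Context (mu0 : probability (W1_space R) R).
Context (Gamma : 'M[R]_n) (A : R -> 'cV[R]_n) (K : R).
Hypothesis mA : forall i, measurable_fun setT (fun x => A x i 0).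
Hypothesis AK : forall x, norm2 (A x) <= K.
Implicit Types (V : W1_space R) (q : loop_space beta) (y : 'cV[R]_n).

Local Notation G := (obs_mean pi0 A).
Local Notation S := (inv_sqrtmx Gamma).
Local Notation Phi := (neg_log_lik pi0 Gamma A).
Local Notation gibbsm := (gibbs_measure beta_gt0 M_gt0 free).

Let K0 : 0 <= K. Proof. exact: le_trans (norm2_ge0 _) (AK 0). Qed.

Lemma measurable_loop_average i : measurable_fun [set: loop_space beta]
  (loop_average (beta := beta) (fun x => A x i 0)).
Proof.
apply: measurable_funM => //.
exact: (measurable_time_integral (measurable_path_comp beta_gt0 (mA i))).
Qed.

Lemma loop_average_le i q : `|loop_average (fun x => A x i 0) q| <= K.
Proof.
rewrite /loop_average normrM gtr0_norm ?invr_gt0// ler_pdivrMl// mulrC.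
have [] // := @ae_bounded_integral R beta beta_gt0 (fun t => A (q t) i 0) K K0.
  exact: (measurable_section q (measurable_path_comp beta_gt0 (mA i))).
by apply: nearW => t _; exact: le_trans (coord_le_norm2 _ _) (AK _).
Qed.

Lemma obs_mean_le V i : `|G V i 0| <= K.
Proof.
rewrite mxE.
set f := fun q => (loop_average (fun x => A x i 0) q)%:E.
change (`|fine (\int[gibbsm V]_q f q)| <= K).
have mf : measurable_fun setT f.
  by apply/measurable_EFinP; exact: measurable_loop_average.
have le : (`|\int[gibbsm V]_q f q| <= K%:E)%E.
  apply: le_trans (le_abse_integral _ measurableT mf) _.
  rewrite -[leRHS]mule1 -(probability_setT (gibbsm V)) -integral_cst//.
  apply: ge0_le_integral => //; first exact: measurableT_comp.
  by move=> q _; rewrite lee_fin; exact: loop_average_le.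
by rewrite -lee_fin -abse_EFin fineK// fin_num_abs (le_lt_trans le)// ltry.
Qed.

Lemma measurable_obs_mean i :
  measurable_fun [set: W1_space R] (fun V => G V i 0).
Proof.
under eq_fun do rewrite mxE.
set f := fun q => (loop_average (fun x => A x i 0) q)%:E.
have mf : measurable_fun setT f.
  by apply/measurable_EFinP; exact: measurable_loop_average.
apply: (measurableT_comp (f := fine)); first exact: fine_measurable.
change (measurable_fun setT (fun V => \int[gibbsm V]_q f q)%E).
under eq_fun do rewrite integralE.
apply: emeasurable_funB.
- apply: (measurable_fun_integral_kernel (l := gibbsm)) => //.
  + by move=> B mB; exact: measurable_gibbs.
  + exact: measurable_funepos.
- apply: (measurable_fun_integral_kernel (l := gibbsm)) => //.
  + by move=> B mB; exact: measurable_gibbs.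
  + exact: measurable_funeneg.
Qed.

(** The subtraction of the data term in the potential leaves a function that
    is affine in the data. *)
Lemma neg_log_likE y V :
  Phi y V = 2^-1 * norm2 (S *m G V) ^+ 2 - mxdot S y (G V).
Proof.
rewrite /neg_log_lik !norm2_sqr /mxdot mulmxBr.
rewrite !mulr_sumr -!sumrB; apply: eq_bigr => i _.
by rewrite subv_coord; field.
Qed.

Definition lik_const : R := (\sum_i (\sum_j `|S i j|) ^+ 2) * K.

Lemma lik_const_ge0 : 0 <= lik_const.
Proof. by rewrite mulr_ge0// sumr_ge0// => i _; exact: sqr_ge0. Qed.

Lemma neg_log_lik_ge y V : - Phi y V <= lik_const * norm2 y.
Proof.
have := mxdot_le S y (obs_mean_le V); rewrite ler_norml => /andP[_].
rewrite neg_log_likE -/lik_const.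
by have := sqr_ge0 (norm2 (S *m G V)); lra.
Qed.

Lemma neg_log_lik_lipschitz y1 y2 V :
  Phi y2 V - Phi y1 V <= lik_const * norm2 (y1 - y2).
Proof.
have := mxdot_le S (y1 - y2) (obs_mean_le V); rewrite ler_norml => /andP[_].
by rewrite mxdotBl !neg_log_likE -/lik_const; lra.
Qed.

Definition posterior_density y V : R := expR (- Phi y V).

Lemma measurable_neg_log_lik y : measurable_fun setT (Phi y).
Proof.
have -> : Phi y = fun V => 2^-1 * (\sum_i (S *m G V) i 0 ^+ 2) -
    \sum_i (S *m y) i 0 * (S *m G V) i 0.
  by apply/funext => V; rewrite neg_log_likE norm2_sqr.
have mSG i : measurable_fun setT (fun V => (S *m G V) i 0).
  under eq_fun do rewrite mxE.
  apply: measurable_sum => j; apply: measurable_funM => //.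
  exact: measurable_obs_mean.
apply: measurable_funB.
- apply: measurable_funM => //; apply: measurable_sum => i.
  exact: measurable_funX.
- by apply: measurable_sum => i; exact: measurable_funM.
Qed.

Lemma weight_posterior y : weight mu0 (posterior_density y).
Proof.
split.
- apply: measurableT_comp => //; apply: measurableT_comp => //.
  exact: measurable_neg_log_lik.
- by move=> V; exact: expR_gt0.
- exists (expR (lik_const * norm2 y)); apply: nearW => V.
  by rewrite ler_expR neg_log_lik_ge.
Qed.

Definition posterior_measure y : probability (W1_space R) R :=
  mtilt (weight_posterior y).

Definition loop_posterior_measure y : probability (loop_space beta) R :=
  mixture (posterior_measure y) (measurable_gibbs beta_gt0 M_gt0 free).

(** The comparison of the posteriors on potentials passes to the mixtures,
    integration being monotone in the measure. *)
Lemma loop_posterior_le y1 y2 B : measurable B ->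
  (loop_posterior_measure y1 B <=
   (expR (2 * (lik_const * norm2 (y1 - y2))))%:E *
   loop_posterior_measure y2 B)%E.
Proof.
move=> mB; pose k := expR (lik_const * norm2 (y1 - y2)).
have -> : expR (2 * (lik_const * norm2 (y1 - y2))) = k * k.
  by rewrite -expRD mulr_natl mulr2n.
have density_le z1 z2 V : norm2 (z1 - z2) = norm2 (y1 - y2) ->
    posterior_density z1 V <= k * posterior_density z2 V.
  move=> zy; rewrite -expRD ler_expR -zy.
  by have := neg_log_lik_lipschitz z1 z2 V; lra.
have norm2N := norm2BC y1 y2.
have kk0 : 0 <= k * k by rewrite mulr_ge0// expR_ge0.
have post_le C : measurable C ->
    (posterior_measure y1 C <= mscale (NngNum kk0) (posterior_measure y2) C)%E.
  move=> mC; apply: tilt_le_tilt => //; try exact: weight_posterior.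
  - by apply: nearW => V; exact: density_le.
  - by apply: nearW => V; exact: density_le.
have mg := measurable_gibbs beta_gt0 M_gt0 free mB.
apply: (le_trans (ge0_le_measure_integral post_le measurableT _ mg)) => //.
by rewrite ge0_integral_mscale.
Qed.

End posterior_comparison.

Theorem theorem8 (R : realType) (beta M theta s : R) (NT : nat)
    (hbeta : 0 < beta) (hM : 0 < M)
    (pi0 : probability (loop_space beta) R)
    (hpi0 : is_free_loop_measure M pi0)
    (htheta0 : 0 < theta) (htheta1 : theta < 1)
    (hs : Num.max 1 ((theta + 2) / (4 * (1 - theta))) < s)
    (gamma : nat -> R)
    (hgamma : (gamma : nat -> R^o) =O_\oo (fun i : nat => i%:R `^ (- s) : R^o))
    (mu0 : probability (W1_space R) R) (hmu0 : is_prior gamma mu0)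
    (Gamma : 'M[R]_NT) (hGamma : posdefmx Gamma)
    (A : R -> 'cV[R]_NT)
    (hAmeas : forall i, measurable_fun setT (fun x => A x i 0))
    (hAbnd : exists K : R, forall x, norm2 (A x) <= K) :
  forall r : R, 0 < r ->
  exists C : R, 0 < C /\
  forall y1 y2 : 'cV[R]_NT, norm2 y1 < r -> norm2 y2 < r ->
  (dTV (loop_posterior pi0 mu0 Gamma A y1) (loop_posterior pi0 mu0 Gamma A y2)
     <= (C * norm2 (y1 - y2))%:E)%E.
Proof.
move=> r r0; have [K AK] := hAbnd.
pose L := lik_const Gamma K.
have L0 : 0 <= L := lik_const_ge0 Gamma AK.
exists (2 * L * expR (4 * L * r) + 1); split.
  by apply: ltr_wpDl => //; apply: mulr_ge0; [exact: mulr_ge0|exact: expR_ge0].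
move=> y1 y2 y1r y2r; set d := norm2 (y1 - y2).
have d0 : 0 <= d by exact: norm2_ge0.
have dr : d <= 2 * r by exact: norm2B_lt.
pose P y := loop_posterior_measure hbeta hM hpi0 mu0 Gamma hAmeas AK y.
change (dTV (P y1) (P y2) <= ((2 * L * expR (4 * L * r) + 1) * d)%:E)%E.
set x := 2 * (L * d).
have x0 : 0 <= x by apply: mulr_ge0 => //; exact: mulr_ge0.
have le12 B : measurable B -> (P y1 B <= (expR x)%:E * P y2 B)%E.
  by move=> mB; exact: loop_posterior_le.
have le21 B : measurable B -> (P y2 B <= (expR x)%:E * P y1 B)%E.
  move=> mB; have -> : x = 2 * (L * norm2 (y2 - y1)).
    by rewrite norm2BC.
  exact: loop_posterior_le.
have x1 : 1 <= expR x by rewrite -expR0 ler_expR.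
apply: (le_trans (dTV_le_ratio x1 le12 le21)); rewrite lee_fin.
(* convexity of the exponential: [e^x - 1 <= x e^x] *)
have ex : expR x - 1 <= x * expR x.
  have := expR_ge1Dx (- x); rewrite expRN => H.
  have := ler_wpM2r (expR_ge0 x) H.
  by rewrite mulVf ?gt_eqF ?expR_gt0//; lra.
have xr : expR x <= expR (4 * L * r).
  by rewrite ler_expR /x; have := ler_wpM2l L0 dr; lra.
apply: (le_trans ex); apply: (@le_trans _ _ (x * expR (4 * L * r))).
  exact: ler_wpM2l.
by rewrite mulrDl mul1r /x; lra.
Qed.
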